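(* Let $K$ be a compact Hausdorff topological space. Then the Banach lattice $C(K)$ is $1^+$-projective if and only if $K$ is an absolute neighbourhood retract.
   Context: $C(K)$ is the Banach lattice of real-valued continuous functions on $K$ with the supremum norm and pointwise order. A Banach lattice homomorphism is a bounded linear map preserving the lattice operations $\vee,\wedge$. For a real number $\lambda>1$, a Banach lattice $P$ is $\lambda$-projective if whenever $X$ is a Banach lattice, $J$ a closed (order) ideal in $X$ and $Q\colon X\to X/J$ the quotient map, then for every Banach lattice homomorphism $T\colon P\to X/J$ there is a Banach lattice homomorphism $\hat T\colon P\to X$ such that $T=Q\circ\hat T$ and $\|\hat T\|\le\lambda\|T\|$. $P$ is $1^+$-projective if it is $(1+\varepsilon)$-projective for every $\varepsilon>0$. Compact spaces are assumed Hausdorff. A compact space $K$ is an absolute neighbourhood retract (ANR) if whenever $i\colon K\to X$ is a homeomorphism between $K$ and a subspace of a compact space $X$, there exist an open set $U$ with $i(K)\subset U\subset X$ and a continuous function $\phi\colon U\to K$ such that $\phi(i(k))=k$ for all $k\in K$. *)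

(* Defs.v *)
From HB Require Import structures.
From mathcomp Require Import all_boot all_order all_algebra.
From mathcomp Require Import generic_quotient ring_quotient.
From mathcomp Require Import lra.
From mathcomp Require Import all_classical all_reals all_analysis.
Set Implicit Arguments.
Unset Strict Implicit.
Unset Printing Implicit Defensive.
Import Order.TTheory GRing.Theory Num.Theory.
Import numFieldNormedType.Exports.
Local Open Scope classical_set_scope.
Local Open Scope ring_scope.
Local Open Scope quotient_scope.

(* The order is carried by the mixin, as Hierarchy Builder rejects a structure
   joining [Order.Lattice] with [GRing.Zmodule] that is declared after
   [Num.RealDomain].  [vler_norm] says that |x| <= |y| implies
   `|x| <= `|y|, where |x| is the join of x and - x. *)
HB.mixin Record isBanachLattice (R : realType) X
    & CompleteNormedModule R X := {
  vle : X -> X -> Prop;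
  vjoin : X -> X -> X;
  vmeet : X -> X -> X;
  vle_refl : forall x : X, vle x x;
  vle_anti : forall x y : X, vle x y -> vle y x -> x = y;
  vle_trans : forall y x z : X, vle x y -> vle y z -> vle x z;
  vjoin_lub : forall x y z : X, vle (vjoin x y) z <-> vle x z /\ vle y z;
  vmeet_glb : forall x y z : X, vle z (vmeet x y) <-> vle z x /\ vle z y;
  vleD2r : forall z x y : X, vle x y -> vle (x + z) (y + z);
  vleZ : forall (a : R) (x y : X), 0 <= a -> vle x y -> vle (a *: x) (a *: y);
  vler_norm : forall x y : X,
    vle (vjoin x (- x)) (vjoin y (- y)) -> `|x| <= `|y|
}.

#[short(type="banachLatticeType")]
HB.structure Definition BanachLattice (R : realType) :=
  {X of CompleteNormedModule R X & isBanachLattice R X}.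

Definition vabs {R : realType} {X : banachLatticeType R} (x : X) : X :=
  vjoin x (- x).

Section VectorLattice.
Context {R : realType} {X : banachLatticeType R}.
Implicit Types x y z : X.

Lemma vleUl x y : vle x (vjoin x y).
Proof. by have /vjoin_lub[] := vle_refl (vjoin x y). Qed.

Lemma vleUr x y : vle y (vjoin x y).
Proof. by have /vjoin_lub[] := vle_refl (vjoin x y). Qed.

Lemma vleIl x y : vle (vmeet x y) x.
Proof. by have /vmeet_glb[] := vle_refl (vmeet x y). Qed.

Lemma vleIr x y : vle (vmeet x y) y.
Proof. by have /vmeet_glb[] := vle_refl (vmeet x y). Qed.

Lemma vleBlD x y z : vle x (z + y) -> vle (x - y) z.
Proof. by move=> /(vleD2r (- y)); rewrite addrK. Qed.

Lemma vleDBl x y z : vle (x - y) z -> vle x (z + y).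
Proof. by move=> /(vleD2r y); rewrite subrK. Qed.

Lemma vleD x y z t : vle x y -> vle z t -> vle (x + z) (y + t).
Proof.
move=> xy zt; apply: (vle_trans (y + z)); first exact: vleD2r.
by rewrite ![y + _]addrC; exact: vleD2r.
Qed.

Lemma vleN2 x y : vle x y -> vle (- y) (- x).
Proof.
by move=> /(vleD2r (- x - y)); rewrite addrA subrr add0r addrCA subrr addr0.
Qed.

Lemma vle_abs x : vle x (vabs x). Proof. exact: vleUl. Qed.

Lemma vleN_abs x : vle (- x) (vabs x). Proof. exact: vleUr. Qed.

Lemma vabsN x : vabs (- x) = vabs x.
Proof.
rewrite /vabs opprK; apply: vle_anti; apply/vjoin_lub; split;
  by [exact: vleUl|exact: vleUr].
Qed.

Lemma vabs_ge0 x : vle 0 (vabs x).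
Proof.
have : vle (x - x) (vabs x + vabs x).
  by apply: vleD; [exact: vle_abs|exact: vleN_abs].
rewrite subrr -mulr2n -scaler_nat => /(vleZ (2^-1)).
by rewrite scaler0 scalerA mulVf ?pnatr_eq0// scale1r; apply; rewrite invr_ge0.
Qed.

Lemma vabs_id x : vle 0 x -> vabs x = x.
Proof.
move=> x0; apply: vle_anti; last exact: vle_abs.
apply/vjoin_lub; split; first exact: vle_refl.
by have := vleN2 x0; rewrite oppr0 => /vle_trans; apply.
Qed.

Lemma vle_distl x y z : vle 0 z -> vle x (y + (vabs (x - y) + z)).
Proof.
move=> z0; rewrite -[X in vle X _](subrK y) addrC; apply: vleD; first exact: vle_refl.
by rewrite -[X in vle X _]addr0; apply: vleD => //; exact: vle_abs.
Qed.

Lemma vle_distr x y z : vle 0 z -> vle x (y + (z + vabs (x - y))).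
Proof. by rewrite [z + _]addrC; exact: vle_distl. Qed.

Lemma vjoin_dist x y x' y' :
  vle (vabs (vjoin x y - vjoin x' y')) (vabs (x - x') + vabs (y - y')).
Proof.
have H (u v u' v' : X) :
  vle (vjoin u v - vjoin u' v') (vabs (u - u') + vabs (v - v')).
  apply: vleBlD; apply/vjoin_lub; rewrite addrC; split.
    apply: vle_trans (vle_distl u u' (vabs_ge0 (v - v'))) _.
    by apply: vleD2r; exact: vleUl.
  apply: vle_trans (vle_distr v v' (vabs_ge0 (u - u'))) _.
  by apply: vleD2r; exact: vleUr.
apply/vjoin_lub; split; first exact: H.
by rewrite opprB -(vabsN (x - x')) -(vabsN (y - y')) !opprB; exact: H.
Qed.

Lemma vmeet_dist x y x' y' :
  vle (vabs (vmeet x y - vmeet x' y')) (vabs (x - x') + vabs (y - y')).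
Proof.
have H (u v u' v' : X) :
  vle (vmeet u v - vmeet u' v') (vabs (u - u') + vabs (v - v')).
  apply: vleBlD; rewrite addrC; apply: vleDBl; apply/vmeet_glb; split; apply: vleBlD.
    apply: vle_trans (vleIl u v) _.
    exact: (vle_distl u u' (vabs_ge0 (v - v'))).
  apply: vle_trans (vleIr u v) _.
  exact: (vle_distr v v' (vabs_ge0 (u - u'))).
apply/vjoin_lub; split; first exact: H.
by rewrite opprB -(vabsN (x - x')) -(vabsN (y - y')) !opprB; exact: H.
Qed.

Lemma vjoinC x y : vjoin x y = vjoin y x.
Proof.
by apply: vle_anti; apply/vjoin_lub; split; by [exact: vleUl|exact: vleUr].
Qed.

Lemma vjoinA x y z : vjoin x (vjoin y z) = vjoin (vjoin x y) z.
Proof.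
have xyz := vleUl (vjoin x y) z; have xyz' := vleUr x (vjoin y z).
apply: vle_anti; apply/vjoin_lub; split; try apply/vjoin_lub; try split.
- exact: vle_trans (vleUl x y) xyz.
- exact: vle_trans (vleUr x y) xyz.
- exact: vleUr.
- exact: vleUl.
- exact: vle_trans (vleUl y z) xyz'.
- exact: vle_trans (vleUr y z) xyz'.
Qed.

Lemma vmeetA x y z : vmeet x (vmeet y z) = vmeet (vmeet x y) z.
Proof.
have xyz := vleIl (vmeet x y) z; have xyz' := vleIr x (vmeet y z).
apply: vle_anti; apply/vmeet_glb; split; try apply/vmeet_glb; try split.
- exact: vleIl.
- exact: vle_trans xyz' (vleIl y z).
- exact: vle_trans xyz' (vleIr y z).
- exact: vle_trans xyz (vleIl x y).
- exact: vle_trans xyz (vleIr x y).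
- exact: vleIr.
Qed.

Lemma vjoin_r x y : vle x y -> vjoin x y = y.
Proof.
move=> xy; apply: vle_anti; last exact: vleUr.
by apply/vjoin_lub; split => //; exact: vle_refl.
Qed.

Lemma vmeet_l x y : vle x y -> vmeet x y = x.
Proof.
move=> xy; apply: vle_anti; first exact: vleIl.
by apply/vmeet_glb; split => //; exact: vle_refl.
Qed.

Lemma vnorm_abs x : `|vabs x| = `|x|.
Proof.
apply/eqP; rewrite eq_le; apply/andP; split; apply: vler_norm;
  rewrite -/(vabs x) -/(vabs (vabs x)) (vabs_id (vabs_ge0 x));
  exact: vle_refl.
Qed.

End VectorLattice.

(* Closed order ideals: closed solid linear subspaces. *)
Record closedIdeal (R : realType) (X : banachLatticeType R) := ClosedIdeal {
  ideal_set :> set X;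
  ideal0 : ideal_set 0;
  idealD : forall x y, ideal_set x -> ideal_set y -> ideal_set (x + y);
  idealZ : forall (a : R) x, ideal_set x -> ideal_set (a *: x);
  ideal_solid : forall x y, ideal_set y -> vle (vabs x) (vabs y) -> ideal_set x;
  ideal_closed : closed ideal_set
}.

Definition ideal_pred (R : realType) (X : banachLatticeType R)
  (J : closedIdeal X) : {pred X} := fun x => `[< ideal_set J x >].

Section IdealPred.
Context {R : realType} {X : banachLatticeType R} (J : closedIdeal X).

Lemma ideal_predP x : reflect (ideal_set J x) (x \in ideal_pred J).
Proof. exact: asboolP. Qed.

Lemma ideal_pred_zmod_closed : zmod_closed (ideal_pred J).
Proof.
split; first exact/ideal_predP/ideal0.
move=> x y /ideal_predP Jx /ideal_predP Jy; apply/ideal_predP.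
by apply: idealD => //; rewrite -scaleN1r; exact: idealZ.
Qed.

HB.instance Definition _ :=
  GRing.isZmodClosed.Build X (ideal_pred J) ideal_pred_zmod_closed.

End IdealPred.

Definition lquot (R : realType) (X : banachLatticeType R) (J : closedIdeal X) :=
  Quotient.quot (ideal_pred J).

Section Quotient.
Context {R : realType} {X : banachLatticeType R} (J : closedIdeal X).
Local Notation Y := (lquot J).

HB.instance Definition _ := GRing.Zmodule.on Y.
HB.instance Definition _ := ZmodQuotient.on Y.

Definition lquot_map (x : X) : Y := \pi_Y x.
Local Notation Q := lquot_map.

Lemma lquot_mapP x y : Q x = Q y <-> ideal_set J (x - y).
Proof.
split=> [/eqP|Jxy].
  by rewrite -(Quotient.idealrBE (ideal_pred J)) => /ideal_predP.
by apply/eqP; rewrite -(Quotient.idealrBE (ideal_pred J)); apply/ideal_predP.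
Qed.

Lemma lquot_mapK (a : Y) : Q (repr a) = a.
Proof. exact: reprK. Qed.

Lemma lquot_mapD x y : Q (x + y) = Q x + Q y.
Proof. exact: (@pi_addr _ _ _ _ _ Y). Qed.

Lemma lquot_mapN x : Q (- x) = - Q x.
Proof. exact: (@pi_oppr _ _ _ _ _ Y). Qed.

Lemma lquot_map0 : Q 0 = 0.
Proof. exact: (@pi_zeror _ _ _ _ _ Y). Qed.

Lemma lquot_mapB x y : Q (x - y) = Q x - Q y.
Proof. by rewrite lquot_mapD lquot_mapN. Qed.

Definition lquot_scale (a : R) (u : Y) : Y := Q (a *: repr u).

Lemma lquot_scaleE a x : lquot_scale a (Q x) = Q (a *: x).
Proof.
apply/lquot_mapP; rewrite -scalerBr; apply: idealZ.
by apply/lquot_mapP; exact: lquot_mapK.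
Qed.

Let scaleA a b (v : Y) : lquot_scale a (lquot_scale b v) = lquot_scale (a * b) v.
Proof. by rewrite -(lquot_mapK v) !lquot_scaleE scalerA. Qed.

Let scale1 : left_id 1 lquot_scale.
Proof. by move=> v; rewrite -(lquot_mapK v) lquot_scaleE scale1r. Qed.

Let scaleDr : right_distributive lquot_scale +%R.
Proof.
move=> a u v; rewrite -(lquot_mapK u) -(lquot_mapK v).
by rewrite -lquot_mapD !lquot_scaleE -lquot_mapD scalerDr.
Qed.

Let scaleDl (v : Y) : {morph lquot_scale^~ v : a b / a + b}.
Proof.
by move=> a b; rewrite -(lquot_mapK v) !lquot_scaleE -lquot_mapD scalerDl.
Qed.

HB.instance Definition _ := GRing.Zmodule_isLmodule.Build R Y
  scaleA scale1 scaleDr scaleDl.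

Lemma lquot_mapZ a x : Q (a *: x) = a *: Q x.
Proof. by rewrite -lquot_scaleE. Qed.

HB.instance Definition _ :=
  GRing.isZmodMorphism.Build X Y lquot_map lquot_mapB.
HB.instance Definition _ := GRing.isScalable.Build R X Y *:%R lquot_map lquot_mapZ.

Definition lquot_norm (u : Y) : R := inf [set `|x| | x in [set x | Q x = u]].

Let norm_has_inf u : has_inf [set `|x| | x in [set x | Q x = u]].
Proof.
split; first by exists `|repr u|, (repr u) => //=; exact: lquot_mapK.
by exists 0 => _ [x _ <-]; exact: normr_ge0.
Qed.

Let lquot_norm_le x : lquot_norm (Q x) <= `|x|.
Proof. by apply: ge_inf; [exact: (norm_has_inf _).2|exists x]. Qed.

Let lquot_norm_ge0 u : 0 <= lquot_norm u.
Proof.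
apply: lb_le_inf; first exact: (norm_has_inf u).1.
by move=> _ [x _ <-]; exact: normr_ge0.
Qed.

Let lquot_norm_lt u (e : R) : lquot_norm u < e -> exists2 x, Q x = u & `|x| < e.
Proof.
move=> ue; have [_ [x xu <-] xe] := inf_adherent (eps := e - lquot_norm u)
  (ltac:(by rewrite subr_gt0)) (norm_has_inf u).
by exists x => //; move: xe; rewrite /lquot_norm addrC subrK.
Qed.

Let lquot_normD u v : lquot_norm (u + v) <= lquot_norm u + lquot_norm v.
Proof.
apply/ler_addgt0Pr => e e0; have e20 : 0 < e / 2 by rewrite divr_gt0.
have [x xu xe] := @lquot_norm_lt u (lquot_norm u + e / 2) (ltac:(by rewrite ltrDl)).
have [y yv ye] := @lquot_norm_lt v (lquot_norm v + e / 2) (ltac:(by rewrite ltrDl)).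
rewrite -xu -yv -lquot_mapD; apply: le_trans (lquot_norm_le _) _.
rewrite (le_trans (ler_normD _ _))// xu yv.
by rewrite [e]splitr addrACA lerD// ltW.
Qed.

Let lquot_normZ (a : R) u : lquot_norm (a *: u) = `|a| * lquot_norm u.
Proof.
have H (b : R) v : lquot_norm (b *: v) <= `|b| * lquot_norm v.
  have [->|b0] := eqVneq b 0.
    by rewrite normr0 mul0r scale0r -lquot_map0 (le_trans (lquot_norm_le _))// normr0.
  rewrite -ler_pdivrMl ?normr_gt0//; apply: lb_le_inf; first exact: (norm_has_inf v).1.
  move=> _ [x <- <-]; rewrite ler_pdivrMl ?normr_gt0// -lquot_mapZ -normrZ.
  exact: lquot_norm_le.
apply/eqP; rewrite eq_le H/=; have [->|a0] := eqVneq a 0.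
  by rewrite normr0 mul0r.
rewrite -ler_pdivlMl ?normr_gt0// -normfV.
by rewrite -[X in lquot_norm X <= _](scalerK a0).
Qed.

Let lquot_norm0_eq0 u : lquot_norm u = 0 -> u = 0.
Proof.
move=> u0; rewrite -(lquot_mapK u) -lquot_map0; apply/lquot_mapP; rewrite subr0.
apply: ideal_closed => B; rewrite -nbhs_ballE => -[e /= e0 eB].
have [x xu xe] := @lquot_norm_lt u e (ltac:(by rewrite u0)).
exists (repr u - x); split.
  by apply/lquot_mapP; rewrite xu lquot_mapK.
by apply: eB; rewrite -ball_normE /= opprB addrCA subrr addr0.
Qed.

HB.instance Definition _ := Lmodule_isNormed.Build R Y
  lquot_normD lquot_normZ lquot_norm0_eq0.

Lemma lquot_normE (u : Y) : `|u| = inf [set `|x| | x in [set x | Q x = u]].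
Proof. by []. Qed.

Lemma lquot_map_norm_le x : `|Q x| <= `|x|.
Proof. exact: lquot_norm_le. Qed.

Lemma lquot_map_norm_lt (u : Y) (e : R) : `|u| < e -> exists2 x, Q x = u & `|x| < e.
Proof. exact: lquot_norm_lt. Qed.

End Quotient.

Section QuotientLattice.
Context {R : realType} {X : banachLatticeType R} (J : closedIdeal X).
Local Notation Y := (lquot J).
Local Notation Q := (@lquot_map R X J).

(* The order of X/J is the image of the order of X. *)
Definition lquot_le (u v : Y) : Prop :=
  exists x y : X, [/\ Q x = u, Q y = v & vle x y].

Definition lquot_join (u v : Y) : Y := Q (vjoin (repr u) (repr v)).

Definition lquot_meet (u v : Y) : Y := Q (vmeet (repr u) (repr v)).

Let joinQ x y x' y' : Q x = Q x' -> Q y = Q y' -> Q (vjoin x y) = Q (vjoin x' y').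
Proof.
move=> /lquot_mapP xx /lquot_mapP yy; apply/lquot_mapP.
have Jabs z : ideal_set J z -> ideal_set J (vabs z).
  by move=> /ideal_solid; apply; rewrite (vabs_id (vabs_ge0 _)); exact: vle_refl.
apply: ideal_solid (idealD (Jabs _ xx) (Jabs _ yy)) _.
by apply: vle_trans (vle_abs _); exact: vjoin_dist.
Qed.

Let meetQ x y x' y' : Q x = Q x' -> Q y = Q y' -> Q (vmeet x y) = Q (vmeet x' y').
Proof.
move=> /lquot_mapP xx /lquot_mapP yy; apply/lquot_mapP.
have Jabs z : ideal_set J z -> ideal_set J (vabs z).
  by move=> /ideal_solid; apply; rewrite (vabs_id (vabs_ge0 _)); exact: vle_refl.
apply: ideal_solid (idealD (Jabs _ xx) (Jabs _ yy)) _.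
by apply: vle_trans (vle_abs _); exact: vmeet_dist.
Qed.

Let joinE x y : lquot_join (Q x) (Q y) = Q (vjoin x y).
Proof. by apply: joinQ; exact: lquot_mapK. Qed.

Let meetE x y : lquot_meet (Q x) (Q y) = Q (vmeet x y).
Proof. by apply: meetQ; exact: lquot_mapK. Qed.

Let le_joinP x y : lquot_le (Q x) (Q y) <-> Q (vjoin x y) = Q y.
Proof.
split=> [[x' [y' [xx yy /vjoin_r xy]]]|xy].
  by rewrite -[RHS]yy -xy; exact: joinQ.
by exists x, (vjoin x y); split => //; exact: vleUl.
Qed.

Let le_meetP x y : lquot_le (Q x) (Q y) <-> Q (vmeet x y) = Q x.
Proof.
split=> [[x' [y' [xx yy /vmeet_l xy]]]|xy].
  by rewrite -[RHS]xx -xy; exact: meetQ.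
by exists (vmeet x y), y; split => //; exact: vleIr.
Qed.

Let leQ x y : vle x y -> lquot_le (Q x) (Q y).
Proof. by exists x, y. Qed.

Let le_refl u : lquot_le u u.
Proof. by rewrite -(lquot_mapK u); apply: leQ; exact: vle_refl. Qed.

Let le_anti u v : lquot_le u v -> lquot_le v u -> u = v.
Proof.
rewrite -(lquot_mapK u) -(lquot_mapK v) => /le_joinP uv /le_joinP vu.
by rewrite -uv vjoinC.
Qed.

Let le_trans v u w : lquot_le u v -> lquot_le v w -> lquot_le u w.
Proof.
rewrite -(lquot_mapK u) -(lquot_mapK v) -(lquot_mapK w).
move=> /le_joinP uv /le_joinP vw; apply/le_joinP.
rewrite -[RHS]vw -(joinQ uv (erefl (Q (repr w)))) -vjoinA.
by apply: joinQ.
Qed.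

Let join_lub u v w : lquot_le (lquot_join u v) w <-> lquot_le u w /\ lquot_le v w.
Proof.
rewrite -(lquot_mapK u) -(lquot_mapK v) -(lquot_mapK w) joinE; split.
  by move=> h; split; apply: le_trans h; apply: leQ; by [exact: vleUl|exact: vleUr].
move=> [/le_joinP uw /le_joinP vw]; apply/le_joinP.
by rewrite -vjoinA (joinQ (erefl (Q (repr u))) vw).
Qed.

Let meet_glb u v w : lquot_le w (lquot_meet u v) <-> lquot_le w u /\ lquot_le w v.
Proof.
rewrite -(lquot_mapK u) -(lquot_mapK v) -(lquot_mapK w) meetE; split.
  by move=> h; split; apply: (le_trans h); apply: leQ; by [exact: vleIl|exact: vleIr].
move=> [/le_meetP wu /le_meetP wv]; apply/le_meetP.
by rewrite vmeetA (meetQ wu (erefl (Q (repr v)))).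
Qed.

Let leD2r w u v : lquot_le u v -> lquot_le (u + w) (v + w).
Proof.
move=> [x [y [<- <- xy]]]; rewrite -(lquot_mapK w) -!lquot_mapD.
by apply: leQ; exact: vleD2r.
Qed.

Let leZ (a : R) u v : 0 <= a -> lquot_le u v -> lquot_le (a *: u) (a *: v).
Proof.
by move=> a0 [x [y [<- <- xy]]]; rewrite -!lquot_mapZ; apply: leQ; exact: vleZ.
Qed.

Let ler_norm u v : lquot_le (lquot_join u (- u)) (lquot_join v (- v)) -> `|u| <= `|v|.
Proof.
move=> uv; rewrite [leRHS]lquot_normE; apply: lb_le_inf.
  by exists `|repr v|, (repr v) => //=; exact: lquot_mapK.
move=> _ [y /= yv <-]; move: uv; rewrite -{}yv -(lquot_mapK u).
move: (repr u) => {u} x; rewrite -!lquot_mapN !joinE -!/(vabs _) => xy.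
pose x' := vjoin (vmeet x (vabs y)) (- vabs y).
have <- : Q x' = Q x.
  have /le_meetP xy1 : lquot_le (Q x) (Q (vabs y)).
    by apply: le_trans xy; apply: leQ; exact: vle_abs.
  have /le_joinP xy2 : lquot_le (Q (- vabs y)) (Q x).
    have := xy; rewrite /vabs -/(vabs x) -/(vabs y).
    move=> [a [b [ax by_ /vleN2 ab]]].
    apply: (@le_trans (Q (- vabs x))).
      by exists (- b), (- a); rewrite !lquot_mapN ax by_.
    by apply: leQ; have := vleN2 (vleN_abs x); rewrite opprK.
  rewrite -[RHS]xy2 (vjoinC (- vabs y) x).
  exact: (joinQ xy1 (erefl (Q (- vabs y)))).
apply: (@Order.POrderTheory.le_trans _ _ `|x'|); first exact: lquot_map_norm_le.
have y0 := vabs_ge0 y; have Ny0 : vle (- vabs y) 0.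
  by have := vleN2 y0; rewrite oppr0.
apply: vler_norm; rewrite -!/(vabs _); apply/vjoin_lub; split.
  apply/vjoin_lub; split; first exact: vleIr.
  exact: vle_trans Ny0 y0.
by rewrite -[X in vle _ X]opprK; apply: vleN2; exact: vleUr.
Qed.

Let lquot_complete (F : set_system Y) : ProperFilter F -> cauchy F -> cvg F.
Proof.
move=> FF /(cauchyP (R := R)) Fc.
have e0 n : 0 < 2^-1 ^+ n :> R by rewrite exprn_gt0// invr_gt0.
pose e n : R := 2^-1 ^+ n.
have /choice[a Fa] n := Fc (e n) (e0 n).
have ad n : `|a n.+1 - a n| < 2 * e n.
  have [u [/= un unS]] := filter_ex (filterI (Fa n) (Fa n.+1)).
  move: un unS; rewrite -ball_normE /= => un unS.
  have -> : a n.+1 - a n = (a n.+1 - u) - (a n - u) by rewrite opprB addrA subrK.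
  rewrite (Order.POrderTheory.le_lt_trans (ler_normB _ _))//.
  rewrite mulr_natl mulr2n ltrD// (Order.POrderTheory.lt_le_trans unS)//.
  by rewrite /e exprS; apply: ler_piMl; [exact: ltW|rewrite invf_le1// ler1n].
have /choice[d dP] n : exists x : X, Q x = a n.+1 - a n /\ `|x| < 2 * e n.
  by have [x] := lquot_map_norm_lt (ad n); exists x.
have Qs n : Q (repr (a 0) + series d n) = a n.
  have dS m : series d m.+1 = series d m + d m.
    by rewrite /series /= big_nat_recr.
  elim: n => [|n IH]; last by rewrite dS addrA lquot_mapD IH (dP n).1 addrC subrK.
  by rewrite /series /= big_geq// addr0 lquot_mapK.
have /cvg_ex[x dx] : cvgn (series d).
  apply: normed_cvg.
  apply: (@series_le_cvg _ _ (geometric 2 2^-1)) => [n|n|n|].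
  - exact: normr_ge0.
  - by rewrite /geometric/= mulr_ge0// ltW.
  - by rewrite ltW// (dP n).2.
  - by apply: is_cvg_geometric_series; rewrite gtr0_norm ?invr_gt0// invf_lt1// ltr1n.
apply/cvg_ex; exists (Q (repr (a 0) + x)).
apply/cvg_ballP => r r0.
have r20 : 0 < r / 2 by rewrite divr_gt0.
have : \forall n \near \oo, `|x - series d n| < r / 2 /\ e n < r / 2.
  near=> n; split; near: n.
    by move/cvgrPdist_lt : dx; apply.
  have /cvgrPdist_lt/(_ _ r20) := @cvg_expr R 2^-1 (ltac:(by rewrite gtr0_norm ?invr_gt0// invf_lt1// ltr1n)).
  apply: filterS => n; rewrite sub0r normrN ger0_norm// ltW//.
move=> /filter_ex[n [xn en]].
apply: filterS (Fa n) => u; rewrite -!ball_normE/= => un.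
rewrite -(subrK (a n) (Q _)) -addrA (Order.POrderTheory.le_lt_trans (ler_normD _ _))//.
rewrite [r]splitr ltrD//; last exact: Order.POrderTheory.lt_trans en.
rewrite -[X in _ - X](Qs n) -lquot_mapB (Order.POrderTheory.le_lt_trans (lquot_map_norm_le _ _))//.
by rewrite opprD addrACA subrr add0r.
Unshelve. all: by end_near. Qed.

HB.instance Definition _ := Uniform_isComplete.Build Y lquot_complete.

HB.instance Definition _ := isBanachLattice.Build R Y
  le_refl le_anti le_trans join_lub meet_glb leD2r leZ ler_norm.

Lemma lquot_mapU x y : Q (vjoin x y) = vjoin (Q x) (Q y).
Proof. by rewrite -joinE. Qed.

Lemma lquot_mapI x y : Q (vmeet x y) = vmeet (Q x) (Q y).
Proof. by rewrite -meetE. Qed.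

End QuotientLattice.

(* The compactness proof is a phantom argument: it is what makes the supremum
   in [cfun_norm] finite. *)
Definition cont_space (R : realType) (K : topologicalType)
  (cK : compact [set: K]) : Type := continuousType K R.

Section ContinuousFunctions.
Context {R : realType} {K : topologicalType} (cK : compact [set: K]).
Local Notation C := (cont_space R cK).

HB.instance Definition _ := Choice.copy C (continuousType K R).

Definition cfun (f : C) : K -> R := (f : continuousType K R).

Lemma cfunP (f g : C) : cfun f =1 cfun g -> f = g.
Proof. by move=> fg; apply/(@continuousEP K R). Qed.

Lemma cfun_continuous (f : C) : continuous (cfun f).
Proof. exact: (@cts_fun K R f). Qed.

Definition mkcfun (f : K -> R) (cf : continuous f) : C :=
  (mkcts cf : continuousType K R).

Program Definition cfun0 : C := @mkcfun (fun=> 0) _.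
Next Obligation. by move=> x; exact: cvg_cst. Qed.

Program Definition cfun_opp (f : C) : C := @mkcfun (fun t => - cfun f t) _.
Next Obligation. by move=> f x; apply: cvgN; exact: cfun_continuous. Qed.

Program Definition cfun_add (f g : C) : C :=
  @mkcfun (fun t => cfun f t + cfun g t) _.
Next Obligation. by move=> f g x; apply: cvgD; exact: cfun_continuous. Qed.

Program Definition cfun_scale (a : R) (f : C) : C :=
  @mkcfun (fun t => a * cfun f t) _.
Next Obligation.
by move=> a f x; apply: cvgM; [exact: cvg_cst|exact: cfun_continuous].
Qed.

Program Definition cfun_join (f g : C) : C :=
  @mkcfun (fun t => Num.max (cfun f t) (cfun g t)) _.
Next Obligation.
by move=> f g x; apply: continuous_max; exact: cfun_continuous.
Qed.

Program Definition cfun_meet (f g : C) : C :=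
  @mkcfun (fun t => Num.min (cfun f t) (cfun g t)) _.
Next Obligation.
by move=> f g x; apply: continuous_min; exact: cfun_continuous.
Qed.

Definition cfun_le (f g : C) : Prop := forall t, cfun f t <= cfun g t.

Definition cfun_norm (f : C) : R := sup (range (fun t => `|cfun f t|)).

Let addA : associative cfun_add.
Proof. by move=> f g h; apply: cfunP => t; exact: addrA. Qed.
Let addC : commutative cfun_add.
Proof. by move=> f g; apply: cfunP => t; exact: addrC. Qed.
Let add0 : left_id cfun0 cfun_add.
Proof. by move=> f; apply: cfunP => t; exact: add0r. Qed.
Let addN : left_inverse cfun0 cfun_opp cfun_add.
Proof. by move=> f; apply: cfunP => t; exact: addNr. Qed.

HB.instance Definition _ := GRing.isZmodule.Build C addA addC add0 addN.

Let scaleA a b (f : C) : cfun_scale a (cfun_scale b f) = cfun_scale (a * b) f.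
Proof. by apply: cfunP => t; exact: mulrA. Qed.
Let scale1 : left_id 1 cfun_scale.
Proof. by move=> f; apply: cfunP => t; exact: mul1r. Qed.
Let scaleDr : right_distributive cfun_scale +%R.
Proof. by move=> a f g; apply: cfunP => t; exact: mulrDr. Qed.
Let scaleDl (f : C) : {morph cfun_scale^~ f : a b / a + b}.
Proof. by move=> a b; apply: cfunP => t; exact: mulrDl. Qed.

HB.instance Definition _ := GRing.Zmodule_isLmodule.Build R C
  scaleA scale1 scaleDr scaleDl.

Let norm_ub (f : C) t : `|cfun f t| <= cfun_norm f.
Proof.
apply: ub_le_sup; last by exists t.
have : compact (cfun f @` [set: K]).
  by apply: continuous_compact => //; apply: continuous_subspaceT; exact: cfun_continuous.
move=> /compact_bounded[M [Mreal MB]]; exists (M + 1) => _ [s _ <-].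
by apply: (MB (M + 1)) => /=; [rewrite ltrDl|exists s].
Qed.

Let norm_le (f : C) (M : R) : 0 <= M -> (forall t, `|cfun f t| <= M) -> cfun_norm f <= M.
Proof.
move=> M0 fM; rewrite /cfun_norm; have [->|/set0P ne] := eqVneq (range (fun t => `|cfun f t|)) set0.
  by rewrite sup0.
by apply: ge_sup => // _ [t _ <-].
Qed.

Let norm_ge0 (f : C) : 0 <= cfun_norm f.
Proof.
rewrite /cfun_norm; have [->|/set0P[_ [t _ _]]] := eqVneq (range (fun t => `|cfun f t|)) set0.
  by rewrite sup0.
exact: le_trans (norm_ub f t).
Qed.

Let normD (f g : C) : cfun_norm (f + g) <= cfun_norm f + cfun_norm g.
Proof.
apply: norm_le => [|t]; first by rewrite addr_ge0.
by rewrite (le_trans (ler_normD _ _))// lerD.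
Qed.

Let normZ (a : R) (f : C) : cfun_norm (a *: f) = `|a| * cfun_norm f.
Proof.
have H (b : R) (g : C) : cfun_norm (b *: g) <= `|b| * cfun_norm g.
  apply: norm_le => [|t]; first by rewrite mulr_ge0.
  by rewrite [cfun _ _]/(b * cfun g t) normrM ler_wpM2l.
apply/eqP; rewrite eq_le H/=; have [->|a0] := eqVneq a 0.
  by rewrite normr0 mul0r.
rewrite -ler_pdivlMl ?normr_gt0// -normfV.
by rewrite -[X in cfun_norm X <= _](scalerK a0).
Qed.

Let norm0_eq0 (f : C) : cfun_norm f = 0 -> f = 0.
Proof.
move=> f0; apply: cfunP => t; apply/eqP; rewrite -normr_eq0 eq_le normr_ge0 andbT.
by rewrite -[X in _ <= X]f0.
Qed.

HB.instance Definition _ := Lmodule_isNormed.Build R C normD normZ norm0_eq0.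

Lemma cfun_normE (f : C) : `|f| = sup (range (fun t => `|cfun f t|)).
Proof. by []. Qed.

Let cfun_complete (F : set_system C) : ProperFilter F -> cauchy F -> cvg F.
Proof.
move=> FF /(cauchyP (R := R)) Fc.
have Fball (e : R) : 0 < e ->
    exists2 g : C, F (ball g e) & forall f, ball g e f -> forall t, `|cfun g t - cfun f t| < e.
  move=> e0; have [g Fg] := Fc e e0; exists g => // f.
  rewrite -ball_normE /= => gf t; apply: le_lt_trans gf.
  exact: (norm_ub (g - f)).
have /choice[l Fl] t : exists l : R, cfun f t @[f --> F] --> l.
  suff /cvg_ex[l ?] : cvg (cfun f t @[f --> F]) by exists l.
  apply/cauchy_cvgP/cauchyP => e e0; have [g Fg gP] := Fball e e0.
  exists (cfun g t); suff: F [set f | ball (cfun g t) e (cfun f t)] by [].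
  by apply: filterS Fg => f /gP /(_ t); rewrite -ball_normE.
have Fl_le (e : R) : 0 < e ->
    exists2 g : C, F (ball g e) & forall t, `|cfun g t - l t| <= e.
  move=> e0; have [g Fg gP] := Fball e e0; exists g => // t.
  apply/ler_addgt0Pr => r r0; move/cvgrPdist_lt : (Fl t) => /(_ _ r0) Fr.
  have [f [/= fr /gP/(_ t) fg]] := filter_ex (filterI Fr Fg).
  rewrite -(subrK (cfun f t) (cfun g t)) -addrA (le_trans (ler_normD _ _))//.
  by rewrite lerD// ltW// distrC.
have lc : continuous l.
  move=> t; apply/cvgrPdist_le => e e0; have e30 : 0 < e / 3 by rewrite divr_gt0.
  have [g _ gl] := Fl_le _ e30.
  have /cvgrPdist_le/(_ _ e30) := @cfun_continuous g t.
  apply: filterS => s gts.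
  have -> : l t - l s = (l t - cfun g t) + (cfun g t - cfun g s) + (cfun g s - l s).
    by rewrite !subrKA.
  have -> : e = e / 3 + e / 3 + e / 3 by lra.
  by rewrite (le_trans (ler_normD _ _))// lerD// (le_trans (ler_normD _ _))// lerD// distrC.
apply/cvg_ex; exists (mkcfun lc); apply/cvg_ballP => e e0.
have e30 : 0 < e / 3 by rewrite divr_gt0.
have [g Fg gl] := Fl_le _ e30.
apply: filterS Fg => f; rewrite -!ball_normE /= => gf.
rewrite -(subrK g (mkcfun lc)) -addrA (le_lt_trans (ler_normD _ _))//.
have lg : `|mkcfun lc - g| <= e / 3.
  apply: norm_le => [|t]; first exact: ltW.
  by have := gl t; rewrite distrC.
by rewrite (le_lt_trans (lerD lg (ltW gf)))//; lra.
Qed.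

HB.instance Definition _ := Uniform_isComplete.Build C cfun_complete.

Let le_refl (f : C) : cfun_le f f. Proof. by move=> t; exact: lexx. Qed.
Let le_anti (f g : C) : cfun_le f g -> cfun_le g f -> f = g.
Proof. by move=> fg gf; apply: cfunP => t; apply/eqP; rewrite eq_le fg gf. Qed.
Let le_trans (g f h : C) : cfun_le f g -> cfun_le g h -> cfun_le f h.
Proof. by move=> fg gh t; exact: Order.POrderTheory.le_trans (gh t). Qed.
Let join_lub (f g h : C) :
  cfun_le (cfun_join f g) h <-> cfun_le f h /\ cfun_le g h.
Proof.
split=> [H|[fh gh] t]; last by rewrite [cfun (cfun_join _ _) _]/(Num.max _ _) ge_max fh gh.
by split=> t; have := H t; rewrite [cfun (cfun_join _ _) _]/(Num.max _ _) ge_max => /andP[].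
Qed.
Let meet_glb (f g h : C) :
  cfun_le h (cfun_meet f g) <-> cfun_le h f /\ cfun_le h g.
Proof.
split=> [H|[fh gh] t]; last by rewrite [cfun (cfun_meet _ _) _]/(Num.min _ _) le_min fh gh.
by split=> t; have := H t; rewrite [cfun (cfun_meet _ _) _]/(Num.min _ _) le_min => /andP[].
Qed.
Let leD2r (h f g : C) : cfun_le f g -> cfun_le (f + h) (g + h).
Proof. by move=> fg t; apply: lerD. Qed.
Let leZ (a : R) (f g : C) : 0 <= a -> cfun_le f g -> cfun_le (a *: f) (a *: g).
Proof. by move=> a0 fg t; apply: ler_wpM2l. Qed.
Let ler_norm (f g : C) :
  cfun_le (cfun_join f (- f)) (cfun_join g (- g)) -> `|f| <= `|g|.
Proof.
move=> fg; apply: norm_le => [|t]; first exact: norm_ge0.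
apply: Order.POrderTheory.le_trans (norm_ub g t).
have : Num.max (cfun f t) (- cfun f t) <= Num.max (cfun g t) (- cfun g t) := fg t.
by rewrite !maxrN.
Qed.

HB.instance Definition _ := isBanachLattice.Build R C
  le_refl le_anti le_trans join_lub meet_glb leD2r leZ ler_norm.

Lemma cfun_vleE (f g : C) : vle f g = (forall t, cfun f t <= cfun g t).
Proof. by []. Qed.

Lemma cfun_joinE (f g : C) t : cfun (vjoin f g) t = Num.max (cfun f t) (cfun g t).
Proof. by []. Qed.

Lemma cfun_meetE (f g : C) t : cfun (vmeet f g) t = Num.min (cfun f t) (cfun g t).
Proof. by []. Qed.

End ContinuousFunctions.

Section Projectivity.
Context {R : realType}.

Definition bounded_linear (P X : banachLatticeType R) (T : {linear P -> X}) : Prop :=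
  exists M : R, forall x, `|T x| <= M * `|x|.

Definition lattice_hom (P X : banachLatticeType R) (T : {linear P -> X}) : Prop :=
  [/\ bounded_linear T,
      forall x y, T (vjoin x y) = vjoin (T x) (T y) &
      forall x y, T (vmeet x y) = vmeet (T x) (T y)].

Definition opnorm (P X : banachLatticeType R) (T : {linear P -> X}) : R :=
  sup [set `|T x| | x in [set x | `|x| <= 1]].

Definition projective_with (lambda : R) (P : banachLatticeType R) : Prop :=
  forall (X : banachLatticeType R) (J : closedIdeal X) (T : {linear P -> lquot J}),
    lattice_hom T ->
    exists That : {linear P -> X},
      [/\ lattice_hom That,
          forall x, T x = lquot_map J (That x) &
          opnorm That <= lambda * opnorm T].

Definition oneplus_projective (P : banachLatticeType R) : Prop :=
  forall eps : R, 0 < eps -> projective_with (1 + eps) P.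

End Projectivity.

(* The last clause says that [i] is open onto [range i] with the subspace
   topology, i.e. that the inverse of [i : K -> range i] is continuous. *)
Definition topological_embedding (K X : topologicalType) (i : K -> X) : Prop :=
  [/\ injective i, continuous i &
      forall V : set K, open V ->
        exists2 W : set X, open W & i @` V = W `&` range i].

(* [phi] is defined on the subtype [U] with the subspace topology, so that the
   empty space is covered: it has no map from a nonempty [X] into it. *)
Definition is_ANR (K : topologicalType) : Prop :=
  forall (X : topologicalType) (i : K -> X),
    compact [set: X] -> hausdorff_space X -> topological_embedding i ->
    exists (U : set X) (phi : U -> K),
      [/\ open U, range i `<=` U, continuous phi &
          forall (k : K) (Uik : i k \in U), phi (exist _ (i k) Uik) = k].

(* Main.v *)
From HB Require Import structures.
Require Import Defs.
From mathcomp Require Import all_boot all_order all_algebra.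
From mathcomp Require Import all_classical all_reals all_analysis.
From mathcomp Require Import ring lra.
Set Implicit Arguments.
Unset Strict Implicit.
Unset Printing Implicit Defensive.
Import Order.TTheory GRing.Theory Num.Theory.
Import numFieldNormedType.Exports.
Local Open Scope classical_set_scope.
Local Open Scope ring_scope.

(* If C(K) is projective and K embeds in a compact space X, the restriction
   C(X) -> C(K) identifies C(K) with a quotient of C(X), so the identity lifts to
   a lattice homomorphism T : C(K) -> C(X).  On the open set where T 1 > 0 the map
   f |-> T f (x) / T 1 (x) is a unital lattice homomorphism, i.e. the evaluation at
   a point of K depending continuously on x: this is the retraction.

   Conversely, let K be an ANR and T : C(K) -> X/J.  Embed K in the cube
   prod_f [- |f|, |f|] indexed by C(K), with retraction phi : U -> K, and let h be
   a Urysohn function equal to 1 on K and to 0 off U, so that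
   G f := h (f o phi) is a continuous function on the cube.  Lift T 1 to x >= 0 of
   norm at most (1 + eps) |T 1| and each T f to y_f with |y_f| <= |f| x.  By a
   lattice Stone-Weierstrass argument, continuous functions on the cube can be
   evaluated at the family (y_f) inside the ideal generated by x, and
   f |-> (G f)(y) is the required lifting of T.  Identities in the ideal generated
   by x are checked on its real lattice homomorphisms; there are enough of
   them by Zorn's lemma, a replacement for Kakutani's representation theorem. *)

(** * Principal ideals and their real lattice homomorphisms *)

Section VectorLatticeComplements.
Context {R : realType} {X : banachLatticeType R}.
Implicit Types x y z u : X.

Lemma vabs_leP x y : vle (vabs x) y <-> vle x y /\ vle (- x) y.
Proof. exact: vjoin_lub. Qed.

Lemma vjoinDr x y z : vjoin (x + z) (y + z) = vjoin x y + z.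
Proof.
apply: vle_anti.
  by apply/vjoin_lub; split; apply: vleD2r; [exact: vleUl|exact: vleUr].
rewrite addrC -[z]opprK addrC; apply: vleBlD; apply/vjoin_lub.
by split; apply: vleDBl; rewrite opprK; [exact: vleUl|exact: vleUr].
Qed.

Lemma vmeetE x y : vmeet x y = - vjoin (- x) (- y).
Proof.
apply: vle_anti.
  rewrite -[vmeet x y]opprK; apply: vleN2; apply/vjoin_lub.
  by split; apply: vleN2; [exact: vleIl|exact: vleIr].
by apply/vmeet_glb; split; rewrite -[X in vle _ X]opprK; apply: vleN2;
  [exact: vleUl|exact: vleUr].
Qed.

Lemma vle_norm x y : vle 0 x -> vle x y -> `|x| <= `|y|.
Proof.
move=> x0 xy; apply: vler_norm; rewrite -/(vabs x) -/(vabs y) !vabs_id//.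
exact: vle_trans xy.
Qed.

Lemma vle_adherent x y :
  (forall e : R, 0 < e -> exists2 z, vle z y & `|x - z| < e) -> vle x y.
Proof.
move=> H; have : vjoin (x - y) 0 = 0.
  apply/eqP; rewrite -normr_le0; apply/ler_addgt0Pr => e e0; rewrite add0r.
  have [z zy xz] := H _ e0; apply: le_trans (ltW xz).
  rewrite -[leRHS]vnorm_abs; apply: vle_norm; first exact: vleUr.
  apply/vjoin_lub; split; last exact: vabs_ge0.
  apply: vle_trans (vle_abs _); rewrite -[x - y]opprK -[x - z]opprK.
  apply: vleN2; rewrite !opprB; exact: vleD2r.
move=> xy; have := vleUl (x - y) 0; rewrite xy => /vleDBl.
by rewrite add0r.
Qed.

Lemma vleZr (a b : R) u : vle 0 u -> a <= b -> vle (a *: u) (b *: u).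
Proof.
move=> u0 ab; rewrite -[b](subrK a) scalerDl -[X in vle X _]add0r.
apply: vleD2r; rewrite -(scaler0 X (b - a)); apply: vleZ => //.
by rewrite subr_ge0.
Qed.

Lemma vle_pZ (a : R) x y : 0 < a -> vle (a *: x) (a *: y) <-> vle x y.
Proof.
move=> a0; split; last by apply: vleZ; exact: ltW.
move=> /(@vleZ _ _ a^-1); rewrite !scalerA mulVf ?gt_eqF// !scale1r.
by apply; rewrite invr_ge0 ltW.
Qed.

Definition principal_ideal u : set X :=
  [set x | exists c : R, vle (vabs x) (c *: u)].

End VectorLatticeComplements.

Section PrincipalIdeal.
Context {R : realType} {X : banachLatticeType R} (u : X).
Hypothesis u0 : vle 0 u.
Local Notation D := (principal_ideal u).

Lemma principal_idealW x : D x ->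
  exists c : R, [/\ 0 <= c, vle x (c *: u) & vle (- c *: u) x].
Proof.
move=> [c /vabs_leP[xc Nxc]]; exists (Num.max 0 c).
have h : vle (c *: u) (Num.max 0 c *: u) by apply: vleZr => //; rewrite le_max lexx orbT.
split; first by rewrite le_max lexx.
  exact: vle_trans h.
by rewrite -[x]opprK scaleNr; apply: vleN2; exact: vle_trans h.
Qed.

Lemma principal_ideal_between (a b : R) x :
  vle (a *: u) x -> vle x (b *: u) -> D x.
Proof.
move=> ax xb; exists (Num.max (- a) b); apply/vabs_leP; split.
  by apply: vle_trans xb _; apply: vleZr => //; rewrite le_max lexx orbT.
apply: (vle_trans (- a *: u)); first by rewrite scaleNr; exact: vleN2.
by apply: vleZr => //; rewrite le_max lexx.
Qed.

Lemma principal_idealU : D u.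
Proof. by apply: (@principal_ideal_between 1 1); rewrite scale1r; exact: vle_refl. Qed.

Lemma principal_idealD x y : D x -> D y -> D (x + y).
Proof.
move=> /principal_idealW[c [_ xc cx]] /principal_idealW[d [_ yd dy]].
by apply: (@principal_ideal_between (- c + - d) (c + d));
  rewrite scalerDl; exact: vleD.
Qed.

Lemma principal_idealN x : D x -> D (- x).
Proof. by move=> [c xc]; exists c; rewrite vabsN. Qed.

Lemma principal_idealB x y : D x -> D y -> D (x - y).
Proof. by move=> Dx /principal_idealN; exact: principal_idealD. Qed.

Lemma principal_ideal_pZ (a : R) x : 0 <= a -> D x -> D (a *: x).
Proof.
move=> a0 /principal_idealW[c [_ xc cx]].
by apply: (@principal_ideal_between (a * - c) (a * c)); rewrite -scalerA; exact: vleZ.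
Qed.

Lemma principal_idealZ (a : R) x : D x -> D (a *: x).
Proof.
move=> Dx; have [a0|a0] := leP 0 a; first exact: principal_ideal_pZ.
rewrite -[a]opprK scaleNr; apply: principal_idealN.
by apply: principal_ideal_pZ => //; rewrite oppr_ge0 ltW.
Qed.

Lemma principal_idealZu (a : R) : D (a *: u).
Proof. exact/principal_idealZ/principal_idealU. Qed.

Lemma principal_ideal0 : D 0.
Proof. by rewrite -(scale0r u); exact: principal_idealZu. Qed.

Lemma principal_ideal_join x y : D x -> D y -> D (vjoin x y).
Proof.
move=> /principal_idealW[c [_ xc cx]] /principal_idealW[d [_ yd dy]].
apply: (@principal_ideal_between (- c) (Num.max c d)).
  exact: vle_trans (vleUl _ _).
by apply/vjoin_lub; split; [apply: vle_trans xc _|apply: vle_trans yd _];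
  apply: vleZr => //; rewrite le_max lexx ?orbT.
Qed.

Lemma principal_ideal_meet x y : D x -> D y -> D (vmeet x y).
Proof.
move=> Dx Dy; rewrite vmeetE; apply: principal_idealN.
by apply: principal_ideal_join; exact: principal_idealN.
Qed.

Lemma vle_archimedean (c : R) x :
  (forall e : R, 0 < e -> vle x ((c + e) *: u)) -> vle x (c *: u).
Proof.
move=> H; apply: vle_adherent => e e0.
pose d := e / (`|u| + 1); have n0 : 0 < `|u| + 1 by rewrite ltr_wpDl.
have d0 : 0 < d by rewrite divr_gt0.
exists (x - d *: u); first by apply: vleBlD; rewrite -scalerDl; exact: H.
rewrite opprB addrCA subrr addr0 normrZ gtr0_norm// /d mulrAC ltr_pdivrMr//.
by rewrite ltr_pM2l// ltrDl.
Qed.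

Definition gauge x : R := inf [set c | vle x (c *: u)].

(* A unital lattice homomorphism on the ideal generated by [u], which serves as
   unit; its values outside this ideal are irrelevant. *)
Record real_hom (psi : X -> R) : Prop := RealHom {
  real_homU : psi u = 1;
  real_homD : forall x y, D x -> D y -> psi (x + y) = psi x + psi y;
  real_homZ : forall (a : R) x, D x -> psi (a *: x) = a * psi x;
  real_hom_join : forall x y, D x -> D y ->
    psi (vjoin x y) = Num.max (psi x) (psi y)
}.

Section RealHomTheory.
Variable psi : X -> R.
Hypothesis hpsi : real_hom psi.

Lemma real_homN x : D x -> psi (- x) = - psi x.
Proof. by move=> Dx; rewrite -scaleN1r (real_homZ hpsi)// mulN1r. Qed.

Lemma real_homB x y : D x -> D y -> psi (x - y) = psi x - psi y.
Proof.
by move=> Dx Dy; rewrite (real_homD hpsi) ?real_homN//; exact: principal_idealN.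
Qed.

Lemma real_homZu (a : R) : psi (a *: u) = a.
Proof.
by rewrite (real_homZ hpsi) ?(real_homU hpsi) ?mulr1//; exact: principal_idealU.
Qed.

Lemma real_hom_le x y : D x -> D y -> vle x y -> psi x <= psi y.
Proof.
by move=> Dx Dy /vjoin_r <-; rewrite (real_hom_join hpsi)// le_max lexx.
Qed.

Lemma real_hom_meet x y : D x -> D y ->
  psi (vmeet x y) = Num.min (psi x) (psi y).
Proof.
move=> Dx Dy; rewrite vmeetE real_homN; last first.
  by apply: principal_ideal_join; exact: principal_idealN.
rewrite (real_hom_join hpsi) ?real_homN// ?oppr_max ?opprK//;
  exact: principal_idealN.
Qed.

Lemma real_hom_norm_le (c : R) x : vle (vabs x) (c *: u) -> `|psi x| <= c.
Proof.
move=> xc; have Dx : D x by exists c.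
have /vabs_leP[h1 h2] := xc; rewrite ler_norml -{2}(real_homZu c).
rewrite real_hom_le ?andbT//; last exact: principal_idealZu.
rewrite lerNl -real_homN// -(real_homZu c); apply: real_hom_le => //.
  exact: principal_idealN.
exact: principal_idealZu.
Qed.

End RealHomTheory.

End PrincipalIdeal.

Section Gauge.
Context {R : realType} {X : banachLatticeType R} (u : X).
Hypotheses (u0 : vle 0 u) (u_neq0 : u != 0).
Local Notation D := (principal_ideal u).

Lemma vle_unit (a b : R) : vle (a *: u) (b *: u) -> a <= b.
Proof.
move=> h; rewrite leNgt; apply/negP => ba; move/eqP : u_neq0; apply.
apply: vle_anti => //; rewrite -(@vle_pZ _ _ (a - b)) ?subr_gt0//.
by rewrite scaler0 scalerBl; apply: vleBlD; rewrite add0r.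
Qed.

Let gauge_has_inf x : D x -> has_inf [set c | vle x (c *: u)].
Proof.
move=> /(principal_idealW u0)[c [_ xc cx]]; split; first by exists c.
by exists (- c) => d /= xd; apply: vle_unit; exact: vle_trans xd.
Qed.

Lemma vle_gauge x : D x -> vle x (gauge u x *: u).
Proof.
move=> Dx; apply: vle_archimedean => // e e0.
have [c /= xc /ltW ce] := inf_adherent e0 (gauge_has_inf Dx).
by apply: vle_trans xc _; exact: vleZr.
Qed.

Lemma gauge_leP x (c : R) : D x -> gauge u x <= c <-> vle x (c *: u).
Proof.
move=> Dx; split => [h|xc].
  by apply: vle_trans (vle_gauge Dx) _; exact: vleZr.
by apply: ge_inf => //; have [] := gauge_has_inf Dx.
Qed.

End Gauge.

Section MaxSublinear.
Context {R : realType} {X : banachLatticeType R} (u : X).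
Hypotheses (u0 : vle 0 u) (u_neq0 : u != 0).
Local Notation D := (principal_ideal u).
Let DD := principal_idealD u0.
Let DZ := principal_idealZ u0.
Let DN := @principal_idealN R X u.
Let DU := principal_ideal_join u0.
Let Du := principal_idealU u0.
Let D0 := principal_ideal0 u0.

(* When the ideal is represented as [C(L)] with [u] the constant [1], these
   are the maps [f |-> max_F f] with [F] a nonempty closed subset of [L]. *)
Record max_sublinear (p : X -> R) : Prop := MaxSublinear {
  max_sublinear_subadd : forall x y, D x -> D y -> p (x + y) <= p x + p y;
  max_sublinear_pZ : forall (a : R) x, 0 < a -> D x -> p (a *: x) = a * p x;
  max_sublinear_join : forall x y, D x -> D y ->
    p (vjoin x y) = Num.max (p x) (p y);
  max_sublinear_shift : forall (c : R) x, D x -> p (x + c *: u) = p x + c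
}.

Section MaxSublinearTheory.
Variable p : X -> R.
Hypothesis hp : max_sublinear p.

Lemma max_sublinear0 : p 0 = 0.
Proof. by have := max_sublinear_pZ hp (a := 2) ltac:(lra) D0; rewrite scaler0; lra. Qed.

Lemma max_sublinearN x : D x -> - p x <= p (- x).
Proof.
move=> Dx; have := max_sublinear_subadd hp Dx (DN Dx).
by rewrite subrr max_sublinear0; lra.
Qed.

Lemma max_sublinear_le_gauge x : D x -> p x <= gauge u x.
Proof.
move=> Dx; have /vjoin_r := vle_gauge u0 u_neq0 Dx.
move=> /(congr1 p); rewrite (max_sublinear_join hp)//; last exact: principal_idealZu.
rewrite -[_ *: u]add0r (max_sublinear_shift hp)// max_sublinear0 add0r => <-.
by rewrite le_max lexx.
Qed.

End MaxSublinearTheory.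

Lemma gauge_max_sublinear : max_sublinear (gauge u).
Proof.
have le := gauge_leP u0 u_neq0.
have shift (c : R) x : D x -> gauge u (x + c *: u) <= gauge u x + c.
  move=> Dx; have Dc := principal_idealZu u0 c.
  by apply/le; [exact: DD|rewrite scalerDl; apply: vleD2r; exact/vle_gauge].
have pZ (a : R) x : 0 < a -> D x -> gauge u (a *: x) <= a * gauge u x.
  move=> a0 Dx; apply/le; first exact: DZ.
  by rewrite -scalerA; apply: vleZ; [exact: ltW|exact: vle_gauge].
split => [x y Dx Dy|a x a0 Dx|x y Dx Dy|c x Dx].
- apply/le; first exact: DD.
  by rewrite scalerDl; apply: vleD; exact: vle_gauge.
- apply/eqP; rewrite eq_le pZ//= -ler_pdivlMl//.
  rewrite -{1}[x](scalerK (lt0r_neq0 a0)) pZ ?invr_gt0//; exact: DZ.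
- apply/eqP; rewrite eq_le; apply/andP; split.
    apply/le; first exact: DU.
    apply/vjoin_lub; split; apply/le => //; rewrite le_max lexx ?orbT//.
  have := vle_gauge u0 u_neq0 (DU Dx Dy) => /vjoin_lub[h1 h2].
  by rewrite ge_max; apply/andP; split; apply/le.
- apply/eqP; rewrite eq_le shift//= -lerBrDr.
  rewrite -{1}[x](addrK (c *: u)) -scaleNr; apply: shift.
  exact: DD Dx (principal_idealZu u0 c).
Qed.

(* The members of the family need not be subadditive themselves: this covers
   both chains in [max_sublinear] and the family [x |-> p (x + t a) - t p a]. *)
Section Infimum.
Context {I : Type} (A : set I) (q : I -> X -> R).
Hypotheses
  (A_neq0 : A !=set0)
  (q_dir : forall i j, A i -> A j ->
    exists2 k, A k & forall x, D x -> q k x <= q i x /\ q k x <= q j x)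
  (q_subadd : forall i j, A i -> A j ->
    exists2 k, A k & forall x y, D x -> D y -> q k (x + y) <= q i x + q j y)
  (q_pZ : forall (a : R) i, 0 < a -> A i ->
    exists2 k, A k & forall x, D x -> q k (a *: x) <= a * q i x)
  (q_join : forall i x y, A i -> D x -> D y ->
    q i (vjoin x y) = Num.max (q i x) (q i y))
  (q_shift : forall (c : R) i x, A i -> D x -> q i (x + c *: u) = q i x + c)
  (q0 : forall i, A i -> q i 0 = 0).

Definition family_inf (x : X) : R := inf [set q i x | i in A].

Let q_has_inf x : D x -> has_inf [set q i x | i in A].
Proof.
move=> Dx; split; first by have [i Ai] := A_neq0; exists (q i x), i.
have [c [_ _ cx]] := principal_idealW u0 Dx.
exists (- c) => _ [i Ai <-].
have : q i (- c *: u) <= q i x.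
  rewrite -[in leRHS](vjoin_r cx) q_join//; last exact: principal_idealZu.
  by rewrite le_max lexx.
by rewrite -[_ *: u]add0r q_shift// q0// add0r.
Qed.

Lemma family_inf_le i x : A i -> D x -> family_inf x <= q i x.
Proof. by move=> Ai /q_has_inf[_ h]; apply: ge_inf => //; exists i. Qed.

Let le_family_inf (c : R) x : (forall i, A i -> c <= q i x) -> c <= family_inf x.
Proof.
move=> h; apply: lb_le_inf; first by have [i Ai] := A_neq0; exists (q i x), i.
by move=> _ [i Ai <-]; exact: h.
Qed.

Let family_inf_lt (e : R) x : D x -> 0 < e ->
  exists2 i, A i & q i x < family_inf x + e.
Proof.
by move=> /q_has_inf h e0; have [_ [i Ai <-] ie] := inf_adherent e0 h; exists i.
Qed.

Lemma family_inf_max_sublinear : max_sublinear family_inf.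
Proof.
have pZ (a : R) x : 0 < a -> D x -> family_inf (a *: x) <= a * family_inf x.
  move=> a0 Dx; rewrite -ler_pdivrMl//; apply: le_family_inf => i Ai.
  have [k Ak kx] := q_pZ a0 Ai; rewrite ler_pdivrMl//; apply: le_trans (kx _ Dx).
  by apply: family_inf_le => //; exact: DZ.
split => [x y Dx Dy|a x a0 Dx|x y Dx Dy|c x Dx].
- apply/ler_addgt0Pr => e e0; have e20 : 0 < e / 2 by rewrite divr_gt0.
  have [i Ai ix] := family_inf_lt Dx e20; have [j Aj jy] := family_inf_lt Dy e20.
  have [k Ak kij] := q_subadd Ai Aj.
  by have := family_inf_le Ak (DD Dx Dy); have := kij _ _ Dx Dy; lra.
- apply/eqP; rewrite eq_le pZ//= -ler_pdivlMl//.
  rewrite -{1}[x](scalerK (lt0r_neq0 a0)) pZ ?invr_gt0//; exact: DZ.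
- apply/eqP; rewrite eq_le; apply/andP; split; last first.
    rewrite ge_max; apply/andP; split; apply: le_family_inf => i Ai;
      rewrite q_join// le_max family_inf_le// ?orbT//.
  apply/ler_addgt0Pr => e e0.
  have [i Ai ix] := family_inf_lt Dx e0; have [j Aj jy] := family_inf_lt Dy e0.
  have [k Ak kij] := q_dir Ai Aj.
  apply: le_trans (family_inf_le Ak (DU Dx Dy)) _.
  have [kix _] := kij _ Dx; have [_ kjy] := kij _ Dy.
  by rewrite q_join// addr_maxl ge_max !le_max; apply/andP; split; apply/orP;
    [left|right]; lra.
- apply/eqP; rewrite eq_le; apply/andP; split; last first.
    by apply: le_family_inf => i Ai; rewrite q_shift// lerD2r family_inf_le.
  rewrite -lerBlDr; apply: le_family_inf => i Ai; rewrite lerBlDr -q_shift//.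
  apply: family_inf_le => //; exact: DD Dx (principal_idealZu u0 c).
Qed.

End Infimum.
End MaxSublinear.

Section RealHomExistence.
Context {R : realType} {X : banachLatticeType R} (u : X).
Hypotheses (u0 : vle 0 u) (u_neq0 : u != 0).
Local Notation D := (principal_ideal u).
Let DD := principal_idealD u0.
Let DZ := principal_idealZ u0.
Let DN := @principal_idealN R X u.
Let DU := principal_ideal_join u0.
Let Du := principal_idealU u0.
Let D0 := principal_ideal0 u0.

(* If [p] is the maximum over [F], this is the maximum over the face of [F] on
   which [a] is maximal. *)
Definition face (p : X -> R) (a : X) : X -> R :=
  family_inf [set t : R | 0 <= t] (fun t x => p (x + t *: a) - t * p a).

Section Face.
Variables (p : X -> R) (a : X).
Hypotheses (hp : max_sublinear u p) (Da : D a).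

Let subadd := max_sublinear_subadd hp.
Let pZ := max_sublinear_pZ hp.

Let pZ0 (t : R) x : 0 <= t -> D x -> p (t *: x) = t * p x.
Proof.
rewrite le_eqVlt => /orP[/eqP<- _|]; last exact: pZ.
by rewrite scale0r mul0r (max_sublinear0 u0 hp).
Qed.

Let q_anti (s t : R) x : 0 <= s -> s <= t -> D x ->
  p (x + t *: a) - t * p a <= p (x + s *: a) - s * p a.
Proof.
move=> s0 st Dx; have ts0 : 0 <= t - s by rewrite subr_ge0.
have := subadd (DD Dx (DZ s Da)) (DZ (t - s) Da).
rewrite -addrA -scalerDl (addrC s) subrK pZ0//; lra.
Qed.

Let q_inf_hyps (s t : R) : 0 <= s -> 0 <= t ->
  exists2 k, 0 <= k & forall x, D x ->
    p (x + k *: a) - k * p a <= p (x + s *: a) - s * p a /\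
    p (x + k *: a) - k * p a <= p (x + t *: a) - t * p a.
Proof.
move=> s0 t0; exists (Num.max s t); first by rewrite le_max s0.
by move=> x Dx; split; apply: q_anti; rewrite ?le_max ?lexx ?orbT.
Qed.

Lemma face_max_sublinear : max_sublinear u (face p a).
Proof.
apply: family_inf_max_sublinear => //.
- by exists 0 => /=.
- move=> s t /= s0 t0; exists (s + t); first exact: addr_ge0.
  move=> x y Dx Dy; have := subadd (DD Dx (DZ s Da)) (DD Dy (DZ t Da)).
  by rewrite addrACA -scalerDl; lra.
- move=> c t /= c0 t0; exists (c * t); first by rewrite mulr_ge0// ltW.
  move=> x Dx; rewrite -scalerA -scalerDr pZ//; first by lra.
  exact: DD Dx (DZ _ Da).
- move=> t x y /= t0 Dx Dy.
  by rewrite -vjoinDr (max_sublinear_join hp) ?addr_maxl//; apply: DD => //; exact: DZ.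
- move=> c t x /= t0 Dx; rewrite addrAC (max_sublinear_shift hp); first by lra.
  exact: DD Dx (DZ _ Da).
- by move=> t /= t0; rewrite add0r pZ0// subrr.
Qed.

Let face_le_at (t : R) x : 0 <= t -> D x ->
  face p a x <= p (x + t *: a) - t * p a.
Proof.
move=> t0 Dx.
apply: (@family_inf_le _ _ _ u0 _ [set t : R | 0 <= t]
  (fun t x => p (x + t *: a) - t * p a)) => //.
- by exists 0 => /=.
- move=> s x' y' /= s0 Dx' Dy'.
  by rewrite -vjoinDr (max_sublinear_join hp) ?addr_maxl//; apply: DD => //; exact: DZ.
- move=> c s y /= s0 Dy; rewrite addrAC (max_sublinear_shift hp); first by lra.
  exact: DD Dy (DZ _ Da).
- by move=> s /= s0; rewrite add0r pZ0// subrr.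
Qed.

Lemma face_le x : D x -> face p a x <= p x.
Proof.
by move=> Dx; have := face_le_at (lexx 0) Dx; rewrite scale0r addr0 mul0r subr0.
Qed.

Lemma faceN : face p a (- a) <= - p a.
Proof.
have := face_le_at (@ler01 R) (DN Da).
by rewrite scale1r addNr (max_sublinear0 u0 hp) mul1r add0r.
Qed.

End Face.

Lemma minimal_max_sublinear (p0 : X -> R) : max_sublinear u p0 ->
  exists p, [/\ max_sublinear u p, forall x, D x -> p x <= p0 x &
    forall q, max_sublinear u q -> (forall x, D x -> q x <= p x) ->
      forall x, D x -> p x <= q x].
Proof.
move=> hp0.
pose T := {p | max_sublinear u p /\ forall x, D x -> p x <= p0 x}.
pose le (p q : T) := `[< forall x, D x -> sval q x <= sval p x >].
have t0 : T by exists p0; split.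
have [|p q r /asboolP pq /asboolP qr|A Atot|p pmin] := @ZL_preorder T t0 le.
- by move=> p; apply/asboolP.
- by apply/asboolP => x Dx; apply: le_trans (qr _ Dx) (pq _ Dx).
- have [->|/set0P A0] := eqVneq A set0; first by exists t0.
  have dir (p q : T) : A p -> A q -> exists2 k, A k &
      forall x, D x -> sval k x <= sval p x /\ sval k x <= sval q x.
    move=> Ap Aq; have [/asboolP h|/asboolP h] := Atot _ _ Ap Aq;
      [exists q|exists p] => // x Dx; split=> //; exact: h.
  have ms (p : T) : max_sublinear u (sval p) by have [] := svalP p.
  have msJ (p : T) x y : A p -> D x -> D y ->
      sval p (vjoin x y) = Num.max (sval p x) (sval p y).
    by move=> _; exact: (max_sublinear_join (ms p)).
  have msS (c : R) (p : T) x : A p -> D x -> sval p (x + c *: u) = sval p x + c.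
    by move=> _; exact: (max_sublinear_shift (ms p)).
  have ms0 (p : T) : A p -> sval p 0 = 0 by move=> _; exact: (max_sublinear0 u0 (ms p)).
  pose m := family_inf A (fun p => sval p).
  have m_le (p : T) x : A p -> D x -> m x <= sval p x.
    exact: (family_inf_le u0 A0 msJ msS ms0).
  have hm : max_sublinear u m.
    apply: family_inf_max_sublinear => //.
      move=> p q Ap Aq; have [k Ak kpq] := dir _ _ Ap Aq; exists k => // x y Dx Dy.
      apply: le_trans (max_sublinear_subadd (ms k) Dx Dy) _.
      by apply: lerD; [have [] := kpq _ Dx|have [] := kpq _ Dy].
    by move=> a p a0 Ap; exists p => // x Dx; rewrite (max_sublinear_pZ (ms p)).
  have mp0 x : D x -> m x <= p0 x.
    have [p Ap] := A0; move=> Dx; apply: le_trans (m_le _ _ Ap Dx) _.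
    by have [_] := svalP p; exact.
  by exists (exist _ m (conj hm mp0)) => p Ap; apply/asboolP => x; exact: m_le.
have [hp pp0] := svalP p; exists (sval p); split => // q hq qp.
have qp0 x : D x -> q x <= p0 x by move=> Dx; apply: le_trans (qp _ Dx) (pp0 _ Dx).
have /pmin/asboolP : le p (exist _ q (conj hq qp0)) by exact/asboolP.
exact.
Qed.

(* A minimal [p] equals each of its faces, so [p (- a) = - p a]; thus the
   sublinear map [p] is linear. *)
Lemma real_hom_exists x : D x -> exists2 psi, real_hom u psi & psi x = gauge u x.
Proof.
move=> Dx; have hg := gauge_max_sublinear u0 u_neq0.
have hf := face_max_sublinear hg Dx.
have [p [hp pf pmin]] := minimal_max_sublinear hf.
have pN a : D a -> p (- a) = - p a.
  move=> Da; apply/eqP; rewrite eq_le (max_sublinearN u0 hp)// andbT.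
  apply: le_trans (faceN hp Da).
  by apply: pmin (face_max_sublinear hp Da) _ _ (DN Da) => y; exact: face_le.
have pD a b : D a -> D b -> p (a + b) = p a + p b.
  move=> Da Db; apply/eqP; rewrite eq_le (max_sublinear_subadd hp)//=.
  have := max_sublinear_subadd hp (DN Da) (DN Db).
  by rewrite -opprD !pN//; [lra|exact: DD].
exists p.
  split => //.
  - rewrite -[u]scale1r -[1 *: u]add0r (max_sublinear_shift hp)//.
    by rewrite (max_sublinear0 u0 hp) add0r.
  - move=> a y Dy; have [a0|a0|<-] := ltgtP 0 a.
    + exact: (max_sublinear_pZ hp).
    + rewrite -[a]opprK scaleNr pN; last exact: DZ.
      by rewrite (max_sublinear_pZ hp) ?oppr_gt0//; ring.
    + by rewrite scale0r mul0r (max_sublinear0 u0 hp).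
  - exact: (max_sublinear_join hp).
have := le_trans (pf _ (DN Dx)) (faceN hg Dx).
rewrite pN// lerN2 => h; apply/eqP.
by rewrite eq_le h (max_sublinear_le_gauge u0 u_neq0 hp Dx).
Qed.

End RealHomExistence.

Section RealHomSeparation.
Context {R : realType} {X : banachLatticeType R} (u : X).
Hypothesis u0 : vle 0 u.
Local Notation D := (principal_ideal u).

Lemma real_hom_le_unit (c : R) x : D x ->
  (forall psi, real_hom u psi -> psi x <= c) -> vle x (c *: u).
Proof.
move=> Dx H; have [uE|u_neq0] := eqVneq u 0.
  have [d [_ + _]] := principal_idealW u0 Dx; by rewrite uE !scaler0.
have [psi hpsi psix] := real_hom_exists u0 u_neq0 Dx.
by apply/(gauge_leP u0 u_neq0) => //; rewrite -psix; exact: H.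
Qed.

Lemma real_hom_norm_le_unit (c : R) x : D x ->
  (forall psi, real_hom u psi -> `|psi x| <= c) -> vle (vabs x) (c *: u).
Proof.
move=> Dx H; apply/vabs_leP; split; apply: real_hom_le_unit => //.
- by move=> psi /H; apply: le_trans; exact: ler_norm.
- exact: principal_idealN.
- move=> psi hpsi; rewrite (real_homN hpsi)//.
  by apply: le_trans (H _ hpsi); rewrite -normrN; exact: ler_norm.
Qed.

Lemma real_hom_inj x y : D x -> D y ->
  (forall psi, real_hom u psi -> psi x = psi y) -> x = y.
Proof.
move=> Dx Dy H; apply/eqP; rewrite -subr_eq0 -normr_le0 -vnorm_abs.
rewrite -(normr0 X) -(scale0r u); apply: vle_norm; first exact: vabs_ge0.
apply: real_hom_norm_le_unit => [|psi hpsi]; first exact: principal_idealB.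
by rewrite (real_homB hpsi)// (H _ hpsi) subrr normr0.
Qed.

End RealHomSeparation.

(** * Compactness and the Stone-Weierstrass theorem *)

Section Compactness.
Context {S : topologicalType}.
Hypothesis cS : compact [set: S].

Lemma compact_set_ind (P : set S -> Prop) :
  P set0 -> (forall A B, A `<=` B -> P B -> P A) ->
  (forall A B, P A -> P B -> P (A `|` B)) ->
  (forall s : S, exists2 B, nbhs s B & P B) -> P setT.
Proof.
move=> P0 Pmono PU Ploc; apply: contrapT => PT.
pose F : set_system S := [set A | P (~` A)].
have FF : ProperFilter F.
  apply: Build_ProperFilter_ex.
    move=> A FA; apply: contrapT => nA.
    by apply: PT; apply: Pmono FA => s _ As; apply: nA; exists s.
  split; first by rewrite /F /= setCT.
    by move=> A B; rewrite /F /= setCI; exact: PU.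
  by move=> A B AB; apply: Pmono; exact: subsetC.
have [s [_ Fs]] : [set: S] `&` cluster F !=set0 by apply: cS; exact: filterT.
have [B sB PB] := Ploc s.
have /Fs /(_ sB)[t [Bt]] : F (~` B) by rewrite /F /= setCK.
exact: Bt.
Qed.

Lemma lattice_stone_weierstrass (R : realType) (A : set (S -> R)) (g : S -> R)
    (e : R) (s0 : S) :
  (forall a, A a -> continuous a) ->
  (forall a b, A a -> A b -> A (fun s => Num.max (a s) (b s))) ->
  (forall a b, A a -> A b -> A (fun s => Num.min (a s) (b s))) ->
  (forall p q, exists a, [/\ A a, a p = g p & a q = g q]) ->
  continuous g -> 0 < e ->
  exists2 a, A a & forall s, `|a s - g s| < e.
Proof.
move=> Acont Amax Amin Ag cg e0.
have cB (a b : S -> R) : continuous a -> continuous b ->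
    continuous (fun s => a s - b s).
  by move=> ca cb s; apply: cvgB; [exact: ca|exact: cb].
have lower p : exists a, [/\ A a, a p = g p & forall s, g s - e < a s].
  have [||||a [Aa ap ag]] := @compact_set_ind (fun B => exists a,
      [/\ A a, a p = g p & forall s, B s -> g s - e < a s]).
  - by have [a [Aa ap _]] := Ag p p; exists a.
  - by move=> B C BC [a [Aa ap Ca]]; exists a; split => // s /BC; exact: Ca.
  - move=> B C [a [Aa ap Ba]] [b [Ab bp Cb]]; exists (fun s => Num.max (a s) (b s)).
    split; [exact: Amax|by rewrite ap bp maxxx|move=> s].
    by rewrite lt_max => -[/Ba ->//|/Cb ->]; rewrite orbT.
  - move=> q; have [a [Aa ap aq]] := Ag p q.
    exists [set s | g s - e < a s]; last by exists a.
    have gae : g q - a q < e by rewrite aq subrr.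
    have /cvgr_lt/(_ _ gae) near_e := cB _ _ cg (Acont _ Aa) q.
    by apply: filterS near_e => s /=; lra.
  by exists a; split => // s; exact: ag.
have [||||a [Aa ag ga]] := @compact_set_ind (fun B => exists a,
    [/\ A a, forall s, g s - e < a s & forall s, B s -> a s < g s + e]).
- by have [a [Aa _ ga]] := lower s0; exists a.
- by move=> B C BC [a [Aa ap Ca]]; exists a; split => // s /BC; exact: Ca.
- move=> B C [a [Aa ap Ba]] [b [Ab bp Cb]]; exists (fun s => Num.min (a s) (b s)).
  split=> [|s|s]; [exact: Amin|by rewrite lt_min ap bp|].
  by rewrite gt_min => -[/Ba ->//|/Cb ->]; rewrite orbT.
- move=> p; have [a [Aa ap ga]] := lower p.
  exists [set s | a s < g s + e]; last by exists a.
  have age : a p - g p < e by rewrite ap subrr.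
  have /cvgr_lt/(_ _ age) near_e := cB _ _ (Acont _ Aa) cg p.
  by apply: filterS near_e => s /=; lra.
exists a => // s; have := ag s; have := ga s I; rewrite ltr_norml; lra.
Qed.

End Compactness.

Lemma compact_set_type (T : topologicalType) (A : set T) :
  compact A -> compact [set: A].
Proof.
move=> cA F FF _.
have FA : (set_val @ F) A.
  by apply: (@filterS _ F _ setT _ _ filterT) => a _; exact: set_valP.
have [p [Ap Fp]] := cA _ _ FA.
exists (exist _ p (mem_set Ap)); split => // B C FB [D [[E oE <-] /= Ep] EC].
have [_ [[b Bb <-] Eb]] : ((set_val @` B) `&` E) !=set0.
  apply: Fp; first by apply: (@filterS _ F _ B _ _ FB) => b Bb; exists b.
  exact: open_nbhs_nbhs.
by exists b; split => //; apply: EC.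
Qed.

Lemma hausdorff_set_type (T : topologicalType) (A : set T) :
  hausdorff_space T -> hausdorff_space A.
Proof.
move=> hT p q pq; apply: val_inj; apply: hT => B C pB qC.
have [||r [Br Cr]] := pq (val @^-1` B) (val @^-1` C).
- exact: (@initial_continuous _ _ (val : A -> T) p).
- exact: (@initial_continuous _ _ (val : A -> T) q).
by exists (val r).
Qed.

Lemma compact_embedding (K S : topologicalType) (i : K -> S) :
  compact [set: K] -> hausdorff_space S -> injective i -> continuous i ->
  topological_embedding i.
Proof.
move=> cK hS injI ci; split => // V oV; exists (~` (i @` (~` V))).
  apply: closed_openC; apply: compact_closed => //.
  apply: continuous_compact; first exact: continuous_subspaceT.
  apply: (subclosed_compact _ cK) => //; exact: open_closedC.
apply/seteqP; split=> [_ [k Vk <-]|s [/= nk [k _ ks]]].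
  by split; [move=> [l nVl /injI lk]; apply: nVl; rewrite lk|exists k].
by exists k => //; apply: contrapT => nVk; apply: nk; exists k.
Qed.

Section FunctionalCalculus.
Context {R : realType} {X : banachLatticeType R} (u : X) {S : topologicalType}.
Hypotheses (u0 : vle 0 u) (cS : compact [set: S]).
Variables (s0 : S) (Phi : (X -> R) -> S).
Local Notation D := (principal_ideal u).

Definition realizes (g : S -> R) (y : X) : Prop :=
  D y /\ forall psi, real_hom u psi -> psi y = g (Phi psi).

Hypothesis Phi_sep : forall p q : S, p <> q ->
  exists g y, [/\ continuous g, g p <> g q & realizes g y].

Lemma functional_calculus_approx (g : S -> R) (e : R) : continuous g -> 0 < e ->
  exists2 y, D y & forall psi, real_hom u psi -> `|psi y - g (Phi psi)| <= e.
Proof.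
move=> cg e0; pose A : set (S -> R) := [set a | continuous a /\ exists y, realizes a y].
have [|||p q|a [ca [y [Dy ya]]] ag] :=
    @lattice_stone_weierstrass S cS R A g e s0 _ _ _ _ cg e0.
- by move=> a [].
- move=> a b [ca [y [Dy ya]]] [cb [z [Dz zb]]]; split.
    by move=> s; apply: continuous_max; [exact: ca|exact: cb].
  exists (vjoin y z); split; first exact: principal_ideal_join.
  by move=> psi hpsi; rewrite (real_hom_join hpsi)// ya// zb.
- move=> a b [ca [y [Dy ya]]] [cb [z [Dz zb]]]; split.
    by move=> s; apply: continuous_min; [exact: ca|exact: cb].
  exists (vmeet y z); split; first exact: principal_ideal_meet.
  by move=> psi hpsi; rewrite (real_hom_meet u0 hpsi)// ya// zb.
- have [<-|/eqP pq] := eqVneq p q.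
    exists (fun=> g p); split => //; split; first by move=> s; exact: cvg_cst.
    exists (g p *: u); split; first exact: principal_idealZu.
    by move=> psi hpsi; rewrite (real_homZu u0 hpsi).
  have [b [y [cb bpq [Dy yb]]]] := Phi_sep pq.
  have b0 : b q - b p != 0 by rewrite subr_eq0 eq_sym; exact/eqP.
  pose t := (g q - g p) / (b q - b p).
  exists (fun s => (g p - t * b p) + t * b s); split; last 2 first.
  + by rewrite subrK.
  + have : t * (b q - b p) = g q - g p by rewrite mulfVK.
    lra.
  split.
    move=> s; apply: cvgD; first exact: cvg_cst.
    by apply: cvgM; [exact: cvg_cst|exact: cb].
  exists ((g p - t * b p) *: u + t *: y); split.
    by apply: principal_idealD => //; [exact: principal_idealZu|exact: principal_idealZ].
  move=> psi hpsi; rewrite (real_homD hpsi); first last.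
  + exact: principal_idealZ.
  + exact: principal_idealZu.
  by rewrite (real_homZu u0 hpsi) (real_homZ hpsi)// yb.
- by exists y => // psi hpsi; rewrite ya// ltW.
Qed.

Lemma functional_calculus (g : S -> R) : continuous g -> exists y, realizes g y.
Proof.
move=> cg.
pose B (e : R) := [set y | D y /\
  forall psi, real_hom u psi -> `|psi y - g (Phi psi)| <= e].
have B0 e : 0 < e -> B e !=set0.
  by move=> e0; have [y Dy ye] := functional_calculus_approx cg e0; exists y.
have BS (d e : R) : d <= e -> B d `<=` B e.
  by move=> de y [Dy yd]; split => // psi /yd /le_trans; exact.
have Bdist e y z : B e y -> B e z -> vle (vabs (y - z)) ((2 * e) *: u).
  move=> [Dy ye] [Dz ze]; apply: real_hom_norm_le_unit => //.
    exact: principal_idealB.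
  move=> psi hpsi; rewrite (real_homB hpsi)//.
  have := ye _ hpsi; have := ze _ hpsi; rewrite !ler_norml; lra.
pose F : set_system X := filter_from [set e : R | 0 < e] B.
have FF : ProperFilter F.
  apply: filter_from_proper; last exact: B0.
  apply: filter_from_filter; first by exists 1 => /=.
  move=> d e /= d0 e0; exists (Num.min d e); first by rewrite /= lt_min d0.
  by move=> y By; split; apply: BS By; rewrite ge_min lexx ?orbT.
have /cauchy_cvgP/cvg_ex[l Fl] : cauchy F.
  apply/(cauchyP (R := R)) => d d0; have n0 : 0 < 2 * (`|u| + 1).
    by rewrite mulr_gt0// ltr_wpDl.
  pose e := d / (2 * (`|u| + 1)); have e0 : 0 < e by rewrite divr_gt0.
  have [y By] := B0 _ e0; exists y, e => // z Bz; rewrite -ball_normE /=.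
  rewrite -vnorm_abs; apply: (@le_lt_trans _ _ `|(2 * e) *: u|).
    by apply: vle_norm; [exact: vabs_ge0|exact: Bdist].
  have e20 : 0 < 2 * e by rewrite mulr_gt0.
  have -> : d = 2 * e * (`|u| + 1) by rewrite /e; field; lra.
  by rewrite normrZ gtr0_norm// ltr_pM2l// ltrDl.
have lB e y : 0 < e -> B e y -> vle (vabs (l - y)) ((2 * e) *: u).
  move=> e0 By.
  have H (d : R) : 0 < d -> exists2 z, B e z & `|l - z| < d.
    move=> d0; have [r r0 rd] : F (ball l d) by apply: Fl; exact: nbhsx_ballx.
    have [z Bz] : B (Num.min e r) !=set0 by apply: B0; rewrite lt_min e0.
    exists z; first by apply: BS Bz; rewrite ge_min lexx.
    have : ball l d z by apply: rd; apply: BS Bz; rewrite ge_min lexx orbT.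
    by rewrite -ball_normE.
  apply/vabs_leP; split; apply: vle_adherent => d /H[z Bz ld].
    exists (z - y); last by rewrite opprB addrA subrK.
    by have /vabs_leP[] := Bdist _ _ _ Bz By.
  exists (y - z); last by rewrite opprB opprB addrC addrA subrK -normrN opprB.
  by have /vabs_leP[] := Bdist _ _ _ By Bz.
have Dl : D l.
  have [y By] := B0 _ ltr01; rewrite -(subrK y l); apply: principal_idealD => //.
    by exists (2 * 1); exact: lB.
  by have [] := By.
exists l; split => // psi hpsi; apply/eqP; rewrite -subr_eq0 -normr_le0.
apply/ler_addgt0Pr => e e0; rewrite add0r.
have e30 : 0 < e / 3 by rewrite divr_gt0.
have [y By] := B0 _ e30; have [Dy /(_ _ hpsi) ye] := By.
have := real_hom_norm_le u0 hpsi (lB _ _ e30 By).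
rewrite (real_homB hpsi)//; move: ye; rewrite !ler_norml; lra.
Qed.

End FunctionalCalculus.

(** * Continuous functions on a compact space *)

Section ContinuousFunctionsComplements.
Context {R : realType} {K : topologicalType} (cK : compact [set: K]).
Local Notation C := (cont_space R cK).

Lemma cfun_norm_ub (f : C) t : `|cfun f t| <= `|f|.
Proof.
rewrite cfun_normE; apply: ub_le_sup; last by exists t.
have cf : {within [set: K], continuous (cfun f)}.
  by apply: continuous_subspaceT; exact: cfun_continuous.
have [M [_ fM]] := compact_bounded (continuous_compact cf cK).
exists (M + 1) => _ [s _ <-]; apply: (fM (M + 1)); first by rewrite ltrDl.
by exists s.
Qed.

Lemma cfun_norm_le (f : C) (M : R) :
  0 <= M -> (forall t, `|cfun f t| <= M) -> `|f| <= M.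
Proof.
move=> M0 fM; rewrite cfun_normE; set A := range (fun t => _).
have [->|/set0P A0] := eqVneq A set0; first by rewrite sup0.
by apply: ge_sup => // _ [t _ <-].
Qed.

Definition cfun1 : C := @mkcfun R K cK (fun=> 1) (fun=> @cvg_cst _ _ _ _ _).

Lemma mkcfunE (f : K -> R) (cf : continuous f) t : cfun (mkcfun cK cf) t = f t.
Proof. by []. Qed.

Lemma cfunDE (f g : C) t : cfun (f + g) t = cfun f t + cfun g t.
Proof. by []. Qed.

Lemma cfunBE (f g : C) t : cfun (f - g) t = cfun f t - cfun g t.
Proof. by []. Qed.

Lemma cfunZE (a : R) (f : C) t : cfun (a *: f) t = a * cfun f t.
Proof. by []. Qed.

Lemma cfunZ1 (a : R) t : cfun (a *: cfun1) t = a.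
Proof. exact: mulr1. Qed.

Lemma cfun_vabsE (f : C) t : cfun (vabs f) t = `|cfun f t|.
Proof. exact: maxrN. Qed.

Lemma cfun_vabs_le (f : C) : vle (vabs f) (`|f| *: cfun1).
Proof. by move=> t; rewrite cfun_vabsE cfunZ1; exact: cfun_norm_ub. Qed.

Lemma cfun1_ge0 : vle 0 cfun1.
Proof. by move=> t; exact: ler01. Qed.

Lemma principal_ideal_cfun1 (f : C) : principal_ideal cfun1 f.
Proof. by exists `|f|; exact: cfun_vabs_le. Qed.

Lemma real_hom_eval (psi : C -> R) :
  real_hom cfun1 psi -> exists k, forall f, psi f = cfun f k.
Proof.
move=> hpsi; have Df := principal_ideal_cfun1; apply: contrapT => nk.
have [||||g [g0 _ g1]] := compact_set_ind cK (P := fun B => exists g : C,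
    [/\ psi g = 0, forall t, 0 <= cfun g t & forall t, B t -> 1 <= cfun g t]).
- exists 0; split => [|t|t []]; last exact: lexx.
  by rewrite -(scale0r cfun1) (real_homZ hpsi)// mul0r.
- by move=> A B AB [g [g0 gp gB]]; exists g; split => // t /AB; exact: gB.
- move=> A B [g [g0 gp gA]] [h [h0 hp hB]]; exists (g + h); split.
  + by rewrite (real_homD hpsi)// g0 h0 addr0.
  + by move=> t; apply: addr_ge0.
  + move=> t ABt; rewrite cfunDE;
      have := gp t; have := hp t; case: ABt => [/gA|/hB]; lra.
- move=> k.
  have [f fk] : exists f, psi f != cfun f k.
    apply: contrapT => H; apply: nk; exists k => f; apply/eqP/negPn/negP => fk.
    by apply: H; exists f.
  pose h := vabs (f - psi f *: cfun1).
  have hE t : cfun h t = `|cfun f t - psi f|.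
    by rewrite cfun_vabsE cfunBE cfunZ1.
  have h0 : psi h = 0.
    rewrite (real_hom_join hpsi)// (real_homN hpsi)// (real_homB hpsi)//.
    by rewrite (real_homZu cfun1_ge0 hpsi) subrr oppr0 maxxx.
  have hk : 0 < cfun h k by rewrite hE normr_gt0 subr_eq0 eq_sym.
  pose g := (2 / cfun h k) *: h.
  have gE t : cfun g t = 2 / cfun h k * cfun h t by [].
  exists [set t | 1 < cfun g t]; last first.
    exists g; split=> [|t|t /ltW//]; first by rewrite (real_homZ hpsi)// h0 mulr0.
    rewrite gE; apply: mulr_ge0; last by rewrite hE.
    by apply: divr_ge0 => //; exact: ltW.
  have /cvgr_gt : cfun g @ k --> cfun g k by exact: cfun_continuous.
  by apply; rewrite gE mulfVK ?gt_eqF// ltr1n.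
have : psi cfun1 <= psi g.
  by apply: (real_hom_le hpsi) => //; rewrite cfun_vleE => t; exact: g1.
by rewrite g0 (real_homU hpsi) ler10.
Qed.

End ContinuousFunctionsComplements.

Section Opnorm.
Context {R : realType} {P Y : banachLatticeType R} (T : {linear P -> Y}).

Lemma opnorm_ub (x : P) : bounded_linear T -> `|x| <= 1 -> `|T x| <= opnorm T.
Proof.
move=> [M TM] x1; apply: ub_le_sup; last by exists x.
exists `|M| => _ [z /= z1 <-]; apply: le_trans (TM z) _.
apply: (@le_trans _ _ (`|M| * `|z|)); first by rewrite ler_wpM2r// ler_norm.
by rewrite ler_piMr.
Qed.

Lemma opnorm_le (M : R) : (forall x, `|x| <= 1 -> `|T x| <= M) -> opnorm T <= M.
Proof.
move=> TM; apply: ge_sup; last by move=> _ [x x1 <-]; exact: TM.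
by exists `|T 0|, 0 => //=; rewrite normr0.
Qed.

End Opnorm.

Section CubeEmbedding.
Context {R : realType} {K : topologicalType}.
Hypotheses (cK : compact [set: K]) (hK : hausdorff_space K).
Local Notation C := (cont_space R cK).

Definition cube_set : set (prod_topology (fun _ : C => R)) :=
  [set s | forall f, s f \in `[- `|f|, `|f|]].

Definition cube : topologicalType := set_type cube_set.

Lemma cube_compact : compact [set: cube].
Proof.
apply: compact_set_type; apply: (@tychonoff C (fun=> R) (fun f => [set` `[- `|f|, `|f|]])).
by move=> f; exact: segment_compact.
Qed.

Lemma cube_hausdorff : hausdorff_space cube.
Proof.
apply: hausdorff_set_type; apply: hausdorff_product => f; exact: Rhausdorff.
Qed.

Definition cube_coord (f : C) (s : cube) : R := set_val s f.

Lemma cube_coord_continuous f : continuous (cube_coord f).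
Proof.
move=> s; apply: (@continuous_comp _ _ _ (set_val : cube -> _) (fun s => s f)).
  exact: initial_continuous.
exact: (@proj_continuous C (fun=> R) f).
Qed.

Lemma cube_coord_inj s t : cube_coord^~ s =1 cube_coord^~ t -> s = t.
Proof. by move=> st; apply: val_inj; apply/funext => f; exact: st. Qed.

Lemma cube_point (s : C -> R) : (forall f, `|s f| <= `|f|) ->
  exists t : cube, forall f, cube_coord f t = s f.
Proof.
move=> sP; have Cs : cube_set s.
  by move=> f; have := sP f; rewrite ler_norml /= in_itv.
by exists (exist _ s (mem_set Cs)).
Qed.

Definition cube_embed (k : K) : cube := sval (cid (cube_point (fun f => cfun_norm_ub f k))).

Lemma cube_coord_embed f k : cube_coord f (cube_embed k) = cfun f k.
Proof. by rewrite /cube_embed; case: cid => t /= ->. Qed.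

Lemma cfun_urysohn (V : set K) (k : K) : open V -> V k ->
  exists f : C, cfun f k = 1 /\ forall l, ~ V l -> cfun f l = 0.
Proof.
move=> oV Vk.
have [|||f [cf f0 f1 _]] :=
    @urysohn_ext_itv K R (compact_normal hK cK) (~` V) [set k] 0 1 _ _ _ ltr01.
- exact: open_closedC.
- exact/accessible_closed_set1/hausdorff_accessible.
- by apply/disjoints_subset => l nVl /= lk; apply: nVl; rewrite lk.
exists (mkcfun cK cf); rewrite mkcfunE; split; first by apply: f1; exists k.
by move=> l nVl; rewrite mkcfunE; apply: f0; exists l.
Qed.

Lemma cfun_separates (k l : K) : (forall f : C, cfun f k = cfun f l) -> k = l.
Proof.
move=> kl; apply: contrapT => neq.
have [|//|f [fk fl]] := @cfun_urysohn (~` [set l]) k.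
  by apply/closed_openC/accessible_closed_set1/hausdorff_accessible.
have := kl f; rewrite fk fl => [/eqP|]; first by rewrite oner_eq0.
exact.
Qed.

Lemma cube_embedding : topological_embedding cube_embed.
Proof.
apply: compact_embedding => //; first exact: cube_hausdorff.
  by move=> k l kl; apply: cfun_separates => f; rewrite -!cube_coord_embed kl.
apply: (@continuous_comp_initial _ _ _ set_val) => k; apply/cvg_sup => f.
apply: (@continuous_comp_initial _ K R (fun s : C -> R => s f)
  (fun k => set_val (cube_embed k))) k => k.
have -> : (fun s : C -> R => s f) \o (fun k => set_val (cube_embed k)) = cfun f.
  by apply/funext => l; exact: cube_coord_embed.
exact: cfun_continuous.
Qed.

End CubeEmbedding.

(** * From projectivity to retractions *)

Section ProjectiveANR.
Context {R : realType} {K X : topologicalType} (i : K -> X).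
Hypotheses (cK : compact [set: K]) (hK : hausdorff_space K).
Hypotheses (cX : compact [set: X]) (hX : hausdorff_space X).
Hypothesis ei : topological_embedding i.
Local Notation CK := (cont_space R cK).
Local Notation CX := (cont_space R cX).

Lemma cfun_extension (f : CK) :
  exists g : CX, (forall k, cfun g (i k) = cfun f k) /\ `|g| <= `|f|.
Proof.
have [f0|f_gt0] := leP `|f| 0.
  exists 0; rewrite normr0; split => // k; apply/esym/eqP.
  by rewrite -normr_le0 (le_trans (cfun_norm_ub f k)).
have [injI ci opi] := ei.
have [f' f'E] : exists f' : X -> R^o, forall k, f' (i k) = cfun f k.
  exists (fun x => if pselect (exists k, i k = x) is left h
                   then cfun f (sval (cid h)) else 0) => k.
  case: pselect => [h|]; last by case; exists k.
  by congr cfun; apply: injI; case: cid.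
have cA : closed (range i).
  apply: compact_closed => //; apply: continuous_compact => //.
  exact: continuous_subspaceT.
have cf' : {within range i, continuous f'}.
  apply/continuousP => O oO; apply/open_subspaceP.
  have [|W oW iW] := opi (cfun f @^-1` O).
    by apply: open_comp => // k _; exact: cfun_continuous.
  exists W => //; rewrite -iW; apply/seteqP; split.
    move=> _ [k Ok <-]; split; last by exists k.
    by move: Ok; rewrite /preimage /= -f'E.
  move=> x [Ok [k _ ik]]; exists k => //; rewrite /preimage /= -f'E ik.
  exact: Ok.
have f'_le x : range i x -> `|f' x| <= `|f|.
  by move=> [k _ <-]; rewrite f'E; exact: cfun_norm_ub.
have [g [fg cg gf]] :=
  continuous_bounded_extension (compact_normal hX cX) cA f_gt0 cf' f'_le.
exists (mkcfun cX cg); split.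
  by move=> k; rewrite mkcfunE -fg ?f'E// inE; exists k.
by apply: cfun_norm_le; [exact: ltW|].
Qed.

Definition extension (f : CK) : CX := sval (cid (cfun_extension f)).

Lemma extensionE f k : cfun (extension f) (i k) = cfun f k.
Proof. by rewrite /extension; case: cid => g []. Qed.

Lemma extension_norm f : `|extension f| <= `|f|.
Proof. by rewrite /extension; case: cid => g []. Qed.

Definition vanishing_set : set CX := [set f | forall k, cfun f (i k) = 0].

Lemma vanishing_closed : closed vanishing_set.
Proof.
move=> f fcl k; apply/eqP; rewrite -normr_le0; apply/ler_addgt0Pr => e e0.
have [g [gk]] := fcl _ (nbhsx_ballx f e e0).
rewrite add0r -ball_normE /= => fg.
have := cfun_norm_ub (f - g) (i k); rewrite cfunBE gk subr0 => /le_trans; apply.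
exact: ltW.
Qed.

Lemma vanishing_solid (f g : CX) :
  vanishing_set g -> vle (vabs f) (vabs g) -> vanishing_set f.
Proof.
move=> g0 fg k; apply/eqP; rewrite -normr_le0.
by have := fg (i k); rewrite !cfun_vabsE g0 normr0.
Qed.

Lemma vanishing0 : vanishing_set 0. Proof. by []. Qed.

Lemma vanishingD f g : vanishing_set f -> vanishing_set g -> vanishing_set (f + g).
Proof. by move=> f0 g0 k; rewrite cfunDE f0 g0 addr0. Qed.

Lemma vanishingZ (a : R) f : vanishing_set f -> vanishing_set (a *: f).
Proof. by move=> f0 k; rewrite cfunZE f0 mulr0. Qed.

Definition vanishing_ideal : closedIdeal CX :=
  ClosedIdeal vanishing0 vanishingD vanishingZ vanishing_solid vanishing_closed.

Local Notation J := vanishing_ideal.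

Lemma vanishingP (f g : CX) :
  lquot_map J f = lquot_map J g <-> forall k, cfun f (i k) = cfun g (i k).
Proof.
split=> [/lquot_mapP fg k|fg]; last first.
  by apply/lquot_mapP => k; rewrite cfunBE fg subrr.
by apply/eqP; rewrite -subr_eq0 -cfunBE fg.
Qed.

Definition lift_quot (f : CK) : lquot J := lquot_map J (extension f).

Lemma lift_quot_linear : linear lift_quot.
Proof.
move=> a f g; rewrite -lquot_mapZ -lquot_mapD; apply/vanishingP => k.
by rewrite cfunDE cfunZE !extensionE.
Qed.

HB.instance Definition _ :=
  GRing.isLinear.Build R CK (lquot J) *:%R lift_quot lift_quot_linear.

Lemma lift_quot_lattice_hom : lattice_hom lift_quot.
Proof.
split=> [|f g|f g].
- exists 1 => f; rewrite mul1r; apply: le_trans (extension_norm f).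
  exact: lquot_map_norm_le.
- rewrite -lquot_mapU; apply/vanishingP => k.
  by rewrite cfun_joinE !extensionE cfun_joinE.
- rewrite -lquot_mapI; apply/vanishingP => k.
  by rewrite cfun_meetE !extensionE cfun_meetE.
Qed.

Lemma projective_retract (lambda : R) : projective_with lambda CK ->
  exists (U : set X) (phi : U -> K),
    [/\ open U, range i `<=` U, continuous phi &
        forall (k : K) (Uik : i k \in U), phi (exist _ (i k) Uik) = k].
Proof.
move=> /(_ CX J lift_quot lift_quot_lattice_hom)[T [[_ TU _] TJ _]].
have Ti f k : cfun (T f) (i k) = cfun f k.
  by rewrite -(extensionE f); apply: (vanishingP _ _).1; rewrite -TJ.
pose e := cfun (T (cfun1 cK)).
have ei1 k : e (i k) = 1 by rewrite /e Ti.
pose U : set X := [set x | 0 < e x].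
have Uphi (x : U) : exists k, forall f, cfun (T f) (val x) / e (val x) = cfun f k.
  have : 0 < e (val x) by exact: (set_valP x).
  move: (val x) => y ey.
  apply: (real_hom_eval (psi := fun f => cfun (T f) y / e y)).
  split=> [|f g _ _|a f _|f g _ _].
  - by rewrite divff// gt_eqF.
  - by rewrite linearD cfunDE mulrDl.
  - by rewrite linearZ cfunZE mulrA.
  - by rewrite TU cfun_joinE maxr_pMl// invr_ge0 ltW.
pose phi (x : U) := sval (cid (Uphi x)).
have phiE x f : cfun f (phi x) = cfun (T f) (val x) / e (val x).
  by rewrite /phi; case: cid.
exists U, phi; split=> [||x|k Uik].
- rewrite (_ : U = e @^-1` [set r | 0 < r])//; apply: open_comp => [x _|].
    exact: cfun_continuous.
  exact: open_gt.
- by move=> _ [k _ <-]; rewrite /U /= ei1.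
- move=> V; rewrite nbhsE => -[W [oW Wx] WV].
  have [f [fx fW]] := cfun_urysohn (R := R) cK hK oW Wx.
  have cTf : continuous (fun y : U => cfun (T f) (set_val y)).
    move=> y; apply: (@continuous_comp _ _ _ (set_val : U -> X) (cfun (T f))).
      exact: initial_continuous.
    exact: cfun_continuous.
  have Tfx : 0 < cfun (T f) (set_val x).
    have ex : 0 < e (set_val x) := set_valP x.
    have := phiE x f; rewrite fx => Tfe.
    by rewrite -(divfK (lt0r_neq0 ex) (cfun (T f) _)) -Tfe mul1r.
  have /cvgr_gt/(_ _ Tfx) Tf_near := cTf x.
  apply: filterS Tf_near => y Tfy; apply: WV; apply: contrapT => /fW; rewrite phiE => /eqP.
  have ey : 0 < e (set_val y) := set_valP y.
  by rewrite mulf_eq0 invr_eq0 (gt_eqF ey) (gt_eqF Tfy).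
- by apply: (@cfun_separates R K cK hK (phi _) k) => f; rewrite phiE /= Ti ei1 divr1.
Qed.

End ProjectiveANR.

(** * From retractions to projectivity *)

Lemma ANR_extension_operator {R : realType} (K S : topologicalType)
    (cK : compact [set: K]) (i : K -> S) :
  is_ANR K -> compact [set: S] -> hausdorff_space S -> topological_embedding i ->
  exists G : cont_space R cK -> S -> R,
    [/\ forall f, continuous (G f), forall f k, G f (i k) = cfun f k &
        forall s, (forall f, G f s = 0) \/
          exists c k, [/\ 0 <= c, c <= 1 & forall f, G f s = c * cfun f k]].
Proof.
move=> aK cS hS ei; have [U [phi [oU iU cphi phiK]]] := aK S i cS hS ei.
have [_ ci _] := ei.
have [||||h [ch h0 h1 h01]] :=
    @urysohn_ext_itv S R (compact_normal hS cS) (~` U) (range i) 0 1.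
- exact: open_closedC.
- apply: compact_closed => //; apply: continuous_compact => //.
  exact: continuous_subspaceT.
- by apply/disjoints_subset => s nUs [k _ iks]; apply: nUs; rewrite -iks; apply: iU; exists k.
- exact: ltr01.
have {}h0 s : ~ U s -> h s = 0 by move=> nUs; apply: h0; exists s.
have {}h1 k : h (i k) = 1 by apply: h1; exists (i k) => //; exists k.
have {}h01 s : 0 <= h s <= 1.
  by have := h01 (h s) (ex_intro2 _ _ s I erefl); rewrite /= in_itv.
pose F (f : cont_space R cK) := valL_ (0 : R) (fun a : U => cfun f (phi a)).
have FE f (a : U) : F f (set_val a) = cfun f (phi a).
  exact: (congr1 (fun g => g a) (valLK (0 : R) (fun a : U => cfun f (phi a)))).
have cF f s : U s -> {for s, continuous (F f)}.
  move=> Us; have : {within U, continuous (F f)}.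
    apply/subspace_valL_continuousP' => a; apply: continuous_comp.
      exact: cphi.
    exact: cfun_continuous.
  by rewrite continuous_open_subspace// => /(_ s (mem_set Us)).
have GU (s : S) : U s -> exists k, forall f, F f s = cfun f k.
  by move=> Us; exists (phi (exist _ s (mem_set Us))) => // f; rewrite -FE.
exists (fun f s => h s * F f s); split=> [f s|f k|s].
- have [Us|nUs] := pselect (U s).
    by apply: cvgM; [exact: ch|exact: cF].
  rewrite /continuous_at (h0 _ nUs) mul0r; apply/cvgr0Pnorm_lt => e e0.
  have n0 : 0 < `|f| + 1 by rewrite ltr_wpDl.
  have hs : h s < e / (`|f| + 1) by rewrite h0// divr_gt0.
  have /cvgr_lt/(_ _ hs) := ch s.
  apply: filterS => t ht; have [Ut|/h0->] := pselect (U t); last first.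
    by rewrite mul0r normr0.
  have [k Fk] := GU _ Ut; have /andP[ht0 _] := h01 t.
  rewrite normrM (ger0_norm ht0) Fk.
  apply: (@le_lt_trans _ _ (h t * (`|f| + 1))); last by rewrite -ltr_pdivlMr.
  by apply: ler_wpM2l => //; apply: le_trans (cfun_norm_ub f k) _; rewrite lerDl.
- have Uik : i k \in U by apply/mem_set/iU; exists k.
  by rewrite h1 mul1r -[i k]/(set_val (exist _ (i k) Uik)) FE phiK.
- have [Us|/h0->] := pselect (U s); last by left=> f; rewrite mul0r.
  right; have [k Fk] := GU _ Us; have /andP[hs0 hs1] := h01 s.
  by exists (h s), k; split => // f; rewrite Fk.
Qed.

Section QuotientComplements.
Context {R : realType} {X : banachLatticeType R} (J : closedIdeal X).
Local Notation Q := (lquot_map J).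

Lemma lquot_map_le (x y : X) : vle x y -> vle (Q x) (Q y).
Proof. by move=> /vjoin_r <-; rewrite lquot_mapU; exact: vleUl. Qed.

Lemma lquot_map_abs (x : X) : Q (vabs x) = vabs (Q x).
Proof. by rewrite lquot_mapU lquot_mapN. Qed.

Lemma lquot_principal_ideal (u x : X) :
  principal_ideal u x -> principal_ideal (Q u) (Q x).
Proof.
move=> [c /lquot_map_le]; rewrite lquot_map_abs lquot_mapZ => xc; by exists c.
Qed.

Lemma real_hom_lquot (u : X) (theta : lquot J -> R) :
  real_hom (Q u) theta -> real_hom u (theta \o Q).
Proof.
move=> htheta; split=> [|x y Dx Dy|a x Dx|x y Dx Dy] /=.
- exact: (real_homU htheta).
- by rewrite lquot_mapD (real_homD htheta)//; exact: lquot_principal_ideal.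
- by rewrite lquot_mapZ (real_homZ htheta)//; exact: lquot_principal_ideal.
- by rewrite lquot_mapU (real_hom_join htheta)//; exact: lquot_principal_ideal.
Qed.

Lemma lquot_lift_pos (u : lquot J) (lambda : R) : vle 0 u -> 1 < lambda ->
  exists x, [/\ vle 0 x, Q x = u & `|x| <= lambda * `|u|].
Proof.
move=> u0 l1; have [->|u_neq0] := eqVneq u 0.
  by exists 0; rewrite lquot_map0 !normr0 mulr0; split => //; exact: vle_refl.
have /lquot_map_norm_lt[x xu xl] : `|u| < lambda * `|u|.
  by rewrite ltr_pMl// normr_gt0.
exists (vabs x); split; first exact: vabs_ge0.
  by rewrite lquot_map_abs xu vabs_id.
by rewrite vnorm_abs ltW.
Qed.

Lemma lquot_lift_between (x : X) (v : lquot J) : vle 0 x ->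
  vle (vabs v) (Q x) -> exists y, Q y = v /\ vle (vabs y) x.
Proof.
move=> x0 /vabs_leP[vx Nvx].
have Nx0 : vle (- x) x by apply: vle_trans (x0); have := vleN2 x0; rewrite oppr0.
exists (vjoin (vmeet (repr v) x) (- x)); split.
  rewrite lquot_mapU lquot_mapI lquot_mapN lquot_mapK vmeet_l// vjoinC vjoin_r//.
  by rewrite -[X in vle _ X]opprK; exact: vleN2.
apply/vabs_leP; split; first by apply/vjoin_lub; split=> //; exact: vleIr.
by rewrite -[X in vle _ X]opprK; apply: vleN2; exact: vleUr.
Qed.

End QuotientComplements.

Section ANRProjective.
Context {R : realType} {K : topologicalType}.
Hypotheses (cK : compact [set: K]) (hK : hausdorff_space K).
Local Notation C := (cont_space R cK).

Lemma lattice_hom_abs_le (Y : banachLatticeType R) (T : {linear C -> Y}) f :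
  lattice_hom T -> vle (vabs (T f)) (`|f| *: T (cfun1 cK)).
Proof.
move=> [_ TU _]; rewrite /vabs -linearZ -linearN -TU.
have /vjoin_r/(congr1 T) := cfun_vabs_le f; rewrite [X in X = _]TU => <-.
exact: vleUl.
Qed.

Lemma ANR_projective_with (lambda : R) :
  is_ANR K -> 1 < lambda -> projective_with lambda C.
Proof.
move=> aK l1 X J T hT; have [bT TU TI] := hT.
pose u := T (cfun1 cK).
have Tabs f : vle (vabs (T f)) (`|f| *: u) by exact: lattice_hom_abs_le.
have u0 : vle 0 u.
  have /vjoin_r/(congr1 T) := @cfun1_ge0 R K cK.
  by rewrite TU linear0 /u => <-; exact: vleUl.
have [x [x0 xu xl]] := lquot_lift_pos u0 l1.
have /choice[y yP] f : exists y, lquot_map J y = T f /\ vle (vabs y) (`|f| *: x).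
  apply: lquot_lift_between; last by rewrite lquot_mapZ xu.
  by rewrite -(scaler0 _ `|f|); exact: vleZ.
have Dy f : principal_ideal x (y f) by exists `|f|; have [] := yP f.
have [s0 _] := @cube_point R K cK (fun=> 0) (fun f => ltac:(by rewrite normr0)).
have /choice[Phi PhiP] psi : exists s : cube cK,
    real_hom x psi -> forall f, cube_coord f s = psi (y f).
  have [hpsi|npsi] := pselect (real_hom x psi); last by exists s0.
  have [s sP] := @cube_point R K cK (psi \o y)
    (fun f => real_hom_norm_le x0 hpsi (yP f).2).
  by exists s.
have [G [cG GK G01]] :=
  ANR_extension_operator (R := R) cK aK (@cube_compact R K cK) (@cube_hausdorff R K cK)
    (@cube_embedding R K cK hK).
have Phi_sep (p q : cube cK) : p <> q ->
    exists g z, [/\ continuous g, g p <> g q & realizes x Phi g z].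
  move=> pq; have [f fpq] : exists f, cube_coord f p <> cube_coord f q.
    apply: contrapT => H; apply: pq; apply: cube_coord_inj => f.
    by apply: contrapT => fpq; apply: H; exists f.
  exists (cube_coord f), (y f); split => //; first exact: cube_coord_continuous.
  by split => // psi hpsi; rewrite PhiP.
have /choice[S SP] f :=
  functional_calculus x0 (@cube_compact R K cK) s0 Phi_sep (cG f).
have DS f : principal_ideal x (S f) by have [] := SP f.
have SE f psi : real_hom x psi -> psi (S f) = G f (Phi psi) by have [_] := SP f; apply.
have S_linear : linear S.
  move=> a f g; apply: (real_hom_inj x0) => //.
    by apply: principal_idealD => //; exact: principal_idealZ.
  move=> psi hpsi; rewrite (real_homD hpsi)//; last exact: principal_idealZ.
  rewrite (real_homZ hpsi)// !SE//.
  have [G0|[c [k [_ _ Gk]]]] := G01 (Phi psi); first by rewrite !G0 mulr0 addr0.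
  by rewrite !Gk cfunDE cfunZE; ring.
pose L := HB.pack_for {linear C -> X} S (GRing.isLinear.Build R C X *:%R S S_linear).
have S_abs f : vle (vabs (S f)) (`|f| *: x).
  apply: real_hom_norm_le_unit => // psi hpsi; rewrite SE//.
  have [G0|[c [k [c0 c1 Gk]]]] := G01 (Phi psi); first by rewrite G0 normr0.
  rewrite Gk normrM (ger0_norm c0); apply: le_trans (cfun_norm_ub f k).
  by rewrite ler_piMl.
have S_norm f : `|S f| <= `|x| * `|f|.
  rewrite -vnorm_abs mulrC -[`|f|]normr_id -normrZ; apply: vle_norm => //.
  exact: vabs_ge0.
exists L; split.
- split=> [|f g|f g]; first by exists `|x|.
  + apply: (real_hom_inj x0) => //; first exact: principal_ideal_join.
    move=> psi hpsi; rewrite (real_hom_join hpsi)// !SE//.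
    have [G0|[c [k [c0 _ Gk]]]] := G01 (Phi psi); first by rewrite !G0 maxxx.
    by rewrite !Gk cfun_joinE maxr_pMr.
  + apply: (real_hom_inj x0) => //; first exact: principal_ideal_meet.
    move=> psi hpsi; rewrite (real_hom_meet x0 hpsi)// !SE//.
    have [G0|[c [k [c0 _ Gk]]]] := G01 (Phi psi); first by rewrite !G0 minxx.
    by rewrite !Gk cfun_meetE minr_pMr.
- move=> f; have DT g : principal_ideal u (T g) by exists `|g|.
  apply: (real_hom_inj u0) => //.
    by rewrite -xu; exact: lquot_principal_ideal.
  move=> theta htheta.
  have htQ : real_hom x (theta \o lquot_map J) by apply: real_hom_lquot; rewrite xu.
  have htT : real_hom (cfun1 cK) (theta \o T).
    split=> [|g h _ _|a g _|g h _ _] /=; first exact: (real_homU htheta).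
    + by rewrite linearD (real_homD htheta).
    + by rewrite linearZ (real_homZ htheta).
    + by rewrite TU (real_hom_join htheta).
  have [k kE] := real_hom_eval htT.
  have PhiE : Phi (theta \o lquot_map J) = cube_embed cK k.
    apply: cube_coord_inj => g; rewrite PhiP// cube_coord_embed -kE /=.
    by have [-> _] := yP g.
  by rewrite -[theta (lquot_map J _)]/((theta \o lquot_map J) (S f)) SE// PhiE GK -kE.
- apply: opnorm_le => f f1; apply: le_trans (S_norm f) _.
  apply: (@le_trans _ _ `|x|); first by rewrite ler_piMr.
  apply: le_trans xl _; apply: ler_wpM2l; first by rewrite ltW// (lt_trans ltr01).
  apply: opnorm_ub => //; apply: cfun_norm_le => // t.
  by rewrite mkcfunE normr1.
Qed.

End ANRProjective.

Theorem theorem1p4 (R : realType) (K : topologicalType)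
    (cK : compact [set: K]) (hK : hausdorff_space K) :
  oneplus_projective (cont_space R cK) <-> is_ANR K.
Proof.
split=> [PK X i cX hX ei|aK e e0].
  exact: (projective_retract hK cX hX ei (PK 1 ltr01)).
by apply: ANR_projective_with => //; rewrite ltrDl.
Qed.
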